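(* Let $n\ge1$ and let $A$ be an $n\times n$ orthogonal matrix. Let $c_1,\dots,c_n\le1$ and $\chi_i=\chi(c_i)=\sqrt{(1-c_i)/6}$. Suppose $(\mathbb D,\Psi_1,\dots,\Psi_n,-\mathrm i)$ is an embedding of a sample from $\mathrm{IG}_{(c_1,\dots,c_n)}$. Define $$(\hat\Psi_1,\dots,\hat\Psi_n)^{T}=A(\Psi_1,\dots,\Psi_n)^{T},\qquad(\hat\chi_1,\dots,\hat\chi_n)^T=A(\chi_1,\dots,\chi_n)^T,$$ and suppose $\hat\chi_i\ge0$ for all $i$. Let $\hat c_i=1-6\hat\chi_i^2$. Then $\sum_i\hat c_i=\sum_ic_i$; the IG surface $(\mathbb D,\hat\Psi_1,\dots,\hat\Psi_n,-\mathrm i)/{\sim_{(\hat c_1,\dots,\hat c_n)}}$ is well defined, i.e. does not depend on the choice of embedding $\Psi_1,\dots,\Psi_n$; and its law is $\mathrm{IG}_{(\hat c_1,\dots,\hat c_n)}$.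
   Context: IG (imaginary geometry) surfaces. For $c\le1$ let $\chi(c)=\sqrt{(1-c)/6}$. For $\underline c=(c_1,\dots,c_n)$, $c_i\le1$, a $\underline c$-IG surface is an equivalence class of tuples $(D,\Psi_1,\dots,\Psi_n)$, with $D\subset\mathbb C$ bounded open and $\Psi_i$ distributions on $D$, where $(D,\Psi_1,\dots,\Psi_n)\sim_{\underline c}(\tilde D,\tilde\Psi_1,\dots,\tilde\Psi_n)$ if there exist an integer $m$ and a homeomorphism $f:\mathbb C\to\mathbb C$ with $f(D)=\tilde D$, conformal on $D$, such that $\Psi_i=\tilde\Psi_i\circ f-\chi(c_i)\arg f'+2\pi\chi(c_i)m$ for all $i$. (For simply connected $D$, as is the case here, $\arg f'$ is any continuous version of the argument; the choice does not matter because $m$ is arbitrary.) With a marked point $x\in\overline D$, $f$ must also send marked point to marked point. A representative is called an embedding. Let $\mathfrak h$ be the harmonic function on $\mathbb D$ with boundary value $\arg(\mathrm iz)\in[0,2\pi)$ at $z\in\partial\mathbb D$. $\mathrm{IG}_{(c_1,\dots,c_n)}$ is the law of the IG surface $(\mathbb D,h_1+\chi(c_1)\mathfrak h,\dots,h_n+\chi(c_n)\mathfrak h,-\mathrm i)/{\sim_{\underline c}}$, where $h_1,\dots,h_n$ are independent zero-boundary GFFs on $\mathbb D$. *)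

(* Defs.v *)
From HB Require Import structures.
From mathcomp Require Import all_boot all_order all_algebra complex.
From mathcomp Require Import all_classical all_reals all_analysis.
Set Implicit Arguments.
Unset Strict Implicit.
Unset Printing Implicit Defensive.
Import Order.TTheory GRing.Theory Num.Theory numFieldNormedType.Exports.
Local Open Scope classical_set_scope.
Local Open Scope ring_scope.
Local Open Scope complex_scope.

(* [R[i]] itself carries no topology; as a [numClosedFieldType] it gets the one
   of [numFieldNormedType]. *)
Definition Cplx (R : realType) : numClosedFieldType := R[i].

Section Plane.
Context {R : realType}.
Local Notation C := (Cplx R).

Definition cplx (p : R * R) : C := p.1 +i* p.2.

Definition cabs (z : C) : R := Normc.normc z.

Definition minusi : C := 0 -i* 1.

Definition disk : set C := [set z | `|z| < 1].

Definition area_int (D : set C) (g : C -> R) : R :=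
  \int[(lebesgue_measure \x lebesgue_measure)%E]_(p in cplx @^-1` D) g (cplx p).

Definition e_ (b : bool) : R * R := if b then (0, 1) else (1, 0).

(* Iterated partial derivative along the word [w]; [false] is d/dx, [true] is
   d/dy. *)
Definition pderiv (w : seq bool) (g : C -> R) : R * R -> R :=
  foldr (fun b (k : R * R -> R) p => 'D_(e_ b) k p) (g \o cplx) w.

Definition smooth (g : C -> R) := forall w p, differentiable (pderiv w g) p.

Lemma pderivP (a : R) (f g : C -> R) : smooth f -> smooth g ->
  forall w, pderiv w (a *: (f : C -> R^o) + g) =
            a *: (pderiv w f : _ -> R^o) + pderiv w g.
Proof.
move=> sf sg; elim=> [//|b w IH].
apply/funext => p.
rewrite [LHS]/= -/(pderiv w _) IH.
have df : derivable (pderiv w f : R * R -> R^o) p (e_ b).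
  exact: diff_derivable.
have dg : derivable (pderiv w g : R * R -> R^o) p (e_ b).
  exact: diff_derivable.
rewrite deriveD//; last exact: derivableZ.
by rewrite deriveZ.
Qed.

Lemma smoothP (a : R) (f g : C -> R) :
  smooth f -> smooth g -> smooth (a *: (f : C -> R^o) + g).
Proof.
move=> sf sg w p; rewrite pderivP//.
apply: differentiableD; last exact: sg.
exact: differentiableZ.
Qed.

Lemma pderiv0 w : pderiv w (0 : C -> R^o) = (0 : R * R -> R^o).
Proof.
elim: w => [//|b w IH]; apply/funext => p.
by rewrite [LHS]/= -/(pderiv w _) IH derive_cst.
Qed.


Definition supported_in (K : set C) (g : C -> R) := forall z, ~ K z -> g z = 0.

Definition testfun_pred (D : set C) : {pred C -> R^o} :=
  mem [set g : C -> R^o | smooth g /\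
    exists K : set C, [/\ compact K, K `<=` D & supported_in K g]].

Record testfun (D : set C) := TestFun {
  testfun_fun :> C -> R^o ;
  testfunP : testfun_fun \in testfun_pred D }.

HB.instance Definition _ (D : set C) := [isSub for @testfun_fun D].
HB.instance Definition _ (D : set C) := [Choice of testfun D by <:].

Lemma testfun_submod_closed (D : set C) : submod_closed (testfun_pred D).
Proof.
split.
  rewrite inE; split.
    move=> w p; rewrite pderiv0; exact: differentiable_cst.
  by exists set0; split=> //; exact: compact0.
move=> a f g; rewrite !inE => -[sf [K [cK KD f0]]] [sg [L [cL LD g0]]].
split; first exact: smoothP.
exists (K `|` L); split.
- exact: compactU.
- by move=> z [/KD|/LD].
- move=> z /not_orP[Kz Lz]; transitivity (a * f z + g z); first by [].
  by rewrite f0// g0// mulr0 addr0.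
Qed.

HB.instance Definition _ (D : set C) :=
  GRing.isSubmodClosed.Build R (C -> R^o) (testfun_pred D)
    (testfun_submod_closed D).
HB.instance Definition _ (D : set C) :=
  [SubChoice_isSubLmodule of testfun D by <:].

(* Continuity is stated with the seminorms defining the topology of the test
   functions: on each compact set the functional has finite order. *)
Definition distr_pred (D : set C) : {pred testfun D -> R^o} :=
  mem [set T : testfun D -> R^o |
    (forall a f g, T (a *: f + g) = a * T f + T g) /\
    forall K : set C, compact K -> K `<=` D ->
      exists (B : R) (N : nat), forall f : testfun D, supported_in K f ->
        forall M : R,
          (forall w p, (size w <= N)%N -> `|pderiv w f p| <= M) ->
          `|T f| <= B * M].

Record distr (D : set C) := Distr {
  distr_fun :> testfun D -> R^o ;
  distrP : distr_fun \in @distr_pred D }.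

HB.instance Definition _ (D : set C) := [isSub for @distr_fun D].
HB.instance Definition _ (D : set C) := [Choice of distr D by <:].

Lemma distr_submod_closed (D : set C) : submod_closed (@distr_pred D).
Proof.
split.
  rewrite inE; split=> [a f g|K cK KD].
    by rewrite -[RHS]/(a * 0 + 0) mulr0 addr0.
  by exists 0, 0%N => f _ M _; rewrite mul0r normr0.
move=> a S T; rewrite !inE => -[lS cS] [lT cT]; split.
  move=> b f g.
  rewrite -[LHS]/(a * S (b *: f + g) + T (b *: f + g)).
  rewrite -[RHS]/(b * (a * S f + T f) + (a * S g + T g)) lS lT.
  by rewrite !mulrDr !mulrA (mulrC a b) addrACA.
move=> K cK KD.
have [B1 [N1 h1]] := cS K cK KD; have [B2 [N2 h2]] := cT K cK KD.
exists (`|a| * B1 + B2), (maxn N1 N2) => f fK M fM.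
rewrite -[X in `|X|]/(a * S f + T f) (le_trans (ler_normD _ _))//.
rewrite mulrDl normrM -mulrA lerD//.
  apply: ler_wpM2l => //; apply: h1 => // w p wN.
  by apply: fM; rewrite (leq_trans wN)// leq_maxl.
apply: h2 => // w p wN.
by apply: fM; rewrite (leq_trans wN)// leq_maxr.
Qed.

HB.instance Definition _ (D : set C) :=
  GRing.isSubmodClosed.Build R (testfun D -> R^o) (@distr_pred D)
    (distr_submod_closed D).
HB.instance Definition _ (D : set C) :=
  [SubChoice_isSubLmodule of distr D by <:].
HB.instance Definition _ (D : set C) := isPointed.Build (distr D) 0.

Definition cylinders (D : set C) : set (set (distr D)) :=
  [set E | exists (f : testfun D) (B : set R),
    measurable B /\ E = [set T : distr D | B (T f)]].

HB.instance Definition _ (D : set C) :=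
  @isMeasurable.Build (sigma_display (@cylinders D)) (distr D)
    <<s @cylinders D >> (@sigma_algebra0 _ setT _) (@sigma_algebraC _ _)
    (@sigma_algebra_bigcup _ setT _).

Lemma disk_open : open disk.
Proof.
have -> : disk = ball (0 : C) 1.
  by apply/seteqP; split => z; rewrite -ball_normE /ball_/= sub0r normrN.
exact: ball_open.
Qed.

Lemma disk_bounded : bounded_set disk.
Proof.
exists 1; split; first exact: real1.
by move=> M M1 z /ltW/le_trans; apply; exact: ltW.
Qed.

Lemma disk_closure : closure disk minusi.
Proof.
move=> B /nbhs_ballP[e /= e0 eB].
have n1 : `|minusi| = 1 by rewrite normc_def/= expr0n sqrrN expr1n add0r sqrtr1.
have e1 : 1 < 1 + e by rewrite ltrDl.
have p1 : 0 < 1 + e := lt_trans ltr01 e1.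
pose t := e / (1 + e).
have t0 : 0 < t by rewrite divr_gt0.
have t1 : t < 1 by rewrite ltr_pdivrMr// mul1r ltrDr.
exists ((1 - t) * minusi); split.
  by rewrite /disk/= normrM n1 mulr1 gtr0_norm ?subr_gt0// ltrBlDr ltrDl.
apply: eB; rewrite -ball_normE /ball_/= mulrBl mul1r opprB addrC subrK normrM.
by rewrite n1 mulr1 gtr0_norm// ltr_pdivrMr// ltr_pMr.
Qed.

Definition chi (c : R) : R := Num.sqrt ((1 - c) / 6).

Definition homeo (f : C -> C) :=
  exists g : C -> C, [/\ cancel f g, cancel g f, continuous f & continuous g].

Definition conformal_on (D : set C) (f : C -> C) :=
  forall z, D z -> derivable f z 1 /\ 'D_1 f z != 0.

Definition is_arg_on (D : set C) (k : C -> C) (theta : C -> R) :=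
  {within D, continuous theta} /\
  forall z, D z -> k z = (cabs (k z))%:C * (cos (theta z) +i* sin (theta z)).

(* [S] is [T \o f]: testing [T \o f] against [phi] is testing [T] against
   [w |-> phi (f^-1 w) / |f' (f^-1 w)|^2]. *)
Definition is_pullback (D E : set C) (f : C -> C) (T : distr E) (S : distr D) :=
  forall (phi : testfun D) (psi : testfun E),
    (forall z, D z -> phi z = cabs ('D_1 f z) ^+ 2 * psi (f z)) ->
    S phi = T psi.

Record embedding (n : nat) := Embedding {
  dom : set C ;
  dom_open : open dom ;
  dom_bounded : bounded_set dom ;
  marked : C ;
  marked_closure : closure dom marked ;
  fields : n.-tuple (distr dom) }.

(* [Psi_i = Psi~_i \o f - chi_i * theta + 2 pi chi_i m] as distributions, with
   [theta] a continuous version of [arg f'] and the same [m] for all [i]; the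
   common factor [chi_i] is taken out of the last two terms. *)
Definition ig_equiv (n : nat) (c : 'I_n -> R) (X Y : embedding n) :=
  exists (m : int) (f : C -> C) (theta : C -> R),
    [/\ homeo f, f @` dom X = dom Y, conformal_on (dom X) f,
        f (marked X) = marked Y & is_arg_on (dom X) (fun z => 'D_1 f z) theta /\
    forall i, exists2 S : distr (dom X), is_pullback f (tnth (fields Y) i) S &
      forall phi : testfun (dom X), tnth (fields X) i phi = S phi +
        chi (c i) * area_int (dom X)
          (fun z => (2 * pi * m%:~R - theta z) * phi z)].

Record ig_surface (n : nat) (c : 'I_n -> R) := IGSurface {
  embeddings : set (embedding n) ;
  embeddingsP : exists X, embeddings = [set Y | ig_equiv c X Y] }.

Definition ig_class (n : nat) (c : 'I_n -> R) (X : embedding n) : ig_surface c :=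
  IGSurface (ex_intro _ X erefl).

Definition disk_embedding (n : nat) (Psi : n.-tuple (distr disk)) :
  embedding n := Embedding disk_open disk_bounded disk_closure Psi.

HB.instance Definition _ (n : nat) (c : 'I_n -> R) :=
  gen_eqMixin (ig_surface c).
HB.instance Definition _ (n : nat) (c : 'I_n -> R) :=
  gen_choiceMixin (ig_surface c).
HB.instance Definition _ (n : nat) (c : 'I_n -> R) :=
  isPointed.Build (ig_surface c)
    (ig_class c (disk_embedding [tuple of nseq n (0 : distr disk)])).

(* The final sigma-algebra for the maps sending the fields on a given marked
   domain to the surface they embed. *)
Definition ig_measurable (n : nat) (c : 'I_n -> R) : set (set (ig_surface c)) :=
  [set E | forall (D : set C) (oD : open D) (bD : bounded_set D) (x : C)
      (Dx : closure D x),
    measurable [set Psi : n.-tuple (distr D) |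
      E (ig_class c (Embedding oD bD Dx Psi))]].

Lemma ig_measurable0 n (c : 'I_n -> R) : @ig_measurable n c set0.
Proof. by move=> *; exact: measurable0. Qed.

Lemma ig_measurableC n (c : 'I_n -> R) E :
  @ig_measurable n c E -> @ig_measurable n c (~` E).
Proof. by move=> mE D oD bD x Dx; apply: measurableC; exact: mE. Qed.

Lemma ig_measurable_bigcup n (c : 'I_n -> R) (F : (set (ig_surface c))^nat) :
  (forall i, @ig_measurable n c (F i)) -> @ig_measurable n c (\bigcup_i F i).
Proof.
by move=> mF D oD bD x Dx; apply: bigcupT_measurable => i; exact: mF.
Qed.

HB.instance Definition _ (n : nat) (c : 'I_n -> R) :=
  @isMeasurable.Build default_measure_display (ig_surface c)
    (@ig_measurable n c) (@ig_measurable0 n c) (@ig_measurableC n c)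
    (@ig_measurable_bigcup n c).

(* Dirichlet Green function of the disk, normalized by
   [green z w ~ - ln |z - w|]; the value on the diagonal is irrelevant. *)
Definition green (z w : C) : R := ln (cabs (1 - z * conjc w) / cabs (z - w)).

Definition green_energy (phi : C -> R) : R :=
  area_int disk (fun z => area_int disk (fun w => phi z * green z w * phi w)).

(* [normal_prob 0 0] is not the Dirac mass at 0. *)
Definition centered_gaussian (s : R) (B : set R) : \bar R :=
  if s == 0 then \d_(0 : R) B else normal_prob 0 s B.

(* As [h w] is linear, this makes [(h phi)_phi] a jointly Gaussian centered
   process whose covariance is given by the Green function. *)
Definition zero_boundary_GFF d (Omega : measurableType d)
    (P : probability Omega R) (h : {RV P >-> distr disk}) :=
  forall (phi : testfun disk) (B : set R), measurable B ->
    P [set w | B (h w phi)] =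
    centered_gaussian (Num.sqrt (green_energy phi)) B.

Definition mutually_independent d (Omega : measurableType d)
    (P : probability Omega R) d' (T : measurableType d') (n : nat)
    (X : 'I_n -> {RV P >-> T}) :=
  forall E : 'I_n -> set T, (forall i, measurable (E i)) ->
    P [set w | forall i, E i (X i w)] = (\prod_(i < n) P (X i @^-1` E i))%E.

Definition harmonic_on (D : set C) (u : C -> R) :=
  forall p, D (cplx p) ->
    [/\ forall w, (size w <= 1)%N -> differentiable (pderiv w u) p,
        forall w, size w = 2 -> {for p, continuous (pderiv w u)} &
        pderiv [:: false; false] u p + pderiv [:: true; true] u p = 0].

(* The bounded harmonic function on the disk with boundary value
   [arg (i z) \in [0, 2 pi[] at [z], the discontinuity point [-i] of the
   boundary data being exempted; boundedness makes it unique. *)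
Definition is_frakh (u : C -> R) :=
  [/\ harmonic_on disk u,
      exists M : R, forall z, disk z -> `|u z| <= M &
      forall (z : C) (a : R), 0 < a < 2 * pi ->
        (0 +i* 1 : C) * z = cos a +i* sin a ->
        u w @[w --> within disk (nbhs z)] --> a].

Definition IG_law (n : nat) (c : 'I_n -> R)
    (mu : probability (ig_surface c) R) :=
  exists (d : measure_display) (Omega : measurableType d)
    (P : probability Omega R) (h : 'I_n -> {RV P >-> distr disk})
    (frakh : C -> R) (Psi : Omega -> n.-tuple (distr disk)),
    [/\ forall i, zero_boundary_GFF (h i), mutually_independent h,
        is_frakh frakh,
        forall w i (phi : testfun disk), tnth (Psi w) i phi =
          h i w phi + chi (c i) * area_int disk (fun z => frakh z * phi z) &
        forall E, measurable E ->
          mu E = P [set w | E (ig_class c (disk_embedding (Psi w)))]].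

Definition rotate_fields (n : nat) (A : 'M[R]_n) (D : set C)
    (Psi : n.-tuple (distr D)) : n.-tuple (distr D) :=
  [tuple \sum_(j < n) A i j *: tnth Psi j | i < n].

End Plane.

(* Main.v *)
Require Import Defs.
From mathcomp Require Import all_boot all_order all_algebra complex.
From mathcomp Require Import all_classical all_reals all_analysis.
From mathcomp Require Import measurable_realfun.
From mathcomp Require Import ring lra.
Import Order.TTheory GRing.Theory Num.Theory numFieldNormedType.Exports.
Local Open Scope classical_set_scope.
Local Open Scope ring_scope.
Set Implicit Arguments.
Unset Strict Implicit.
Unset Printing Implicit Defensive.

(** Everything rests on one fact: a vector of independent zero-boundary GFFs has the
same law after multiplication by an orthogonal matrix.  The other claims are
linear algebra.

The change-of-coordinates rule of IG surfaces is linear in the pair formed by the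
fields and the constants chi, with the same map, argument and integer for all the
fields.  Hence multiplication of the fields by A carries c-equivalence of
embeddings to hat c-equivalence, and A^T carries it back
([ig_equiv_rotateE]); so A acts on surfaces, measurably
([measurable_rotate_surface]).  The harmonic function occurs in the fields with
the coefficients chi, which A turns into hat chi, and the sum of the c_i only
involves the Euclidean norm of the vector chi.

Invariance of the law ([rotated_fields_joint_law]) is proved with characteristic
functions.  Testing a single field h against phi gives a centered Gaussian of
variance var(phi), so E cos(h phi) = exp(- var(phi) / 2) and E sin(h phi) = 0.
For independent h_j these multiply ([gaussian_family_cos_sin]), and the
characteristic function of a linear functional sum_j h_j(xi_j) depends on xi only
through sum_j var(xi_j).  Passing from the h_j to the rotated fields replaces xi
by its image under A^T, which does not change that sum: var(phi) = E h(phi)^2 and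
the corresponding sums of squares agree before taking expectations
([var_rotate]).

It remains to pass from equality of the characteristic functions of all linear
functionals to equality of laws.  Call f and g Fourier-equal if E (f exp(i X_v)) =
E (g exp(i Y_v)) for all v, where X and Y are the two families of linear
functionals.  This relation is stable under linear combinations, bounded limits,
and multiplication of f and g by cos X_u, sin X_u and cos Y_u, sin Y_u
respectively, hence under multiplication by polynomials in these and by their
bounded limits.  Polynomials in sin converge boundedly to the indicator of
{sin > 0}, and {sin((x - a) / n) > 0} converges to {x > a}; so multiplication by
the indicators of {X_u > a} and {Y_u > a} is allowed, and then, since the
permitted events form a sigma-algebra, by the indicators of all events.  Starting
from f = g = 1 one reaches any finite product of indicators. *)

(** * Moments and characteristic function of the normal law *)

(** The fundamental theorem of calculus on [-n, n] and dominated convergence; both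
boundary terms vanish in the limit. *)
Lemma integral_derive_eq0 (R : realType) (F f : R -> R) :
  (forall x : R, is_derive x (1 : R) F (f x)) -> continuous f ->
  lebesgue_measure.-integrable setT (EFin \o f) ->
  F n.+1%:R @[n --> \oo] --> 0 -> F (- n.+1%:R) @[n --> \oo] --> 0 ->
  (\int[lebesgue_measure]_x (f x)%:E)%E = 0%E.
Proof.
move=> dF cf intf Fy FNy.
pose I n : set R := `[- n.+1%:R, n.+1%:R]%classic.
have cF : continuous F.
  by move=> x; apply/differentiable_continuous/derivable1_diffP; have [] := dF x.
pose f_ n (x : R) := (f x * \1_(I n) x)%:E.
have FTC n : (\int[lebesgue_measure]_x f_ n x)%E =
    (F n.+1%:R - F (- n.+1%:R))%:E.
  transitivity (\int[lebesgue_measure]_(x in I n) (f x)%:E)%E.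
    rewrite [RHS]integral_mkcond; apply: eq_integral => x _.
    by rewrite /f_ patchE indicE; case: ifP; rewrite (mulr1, mulr0).
  rewrite (continuous_FTC2 (F := F)).
  - by rewrite EFinB.
  - by rewrite -subr_gt0 opprK addr_gt0.
  - exact: continuous_subspaceT.
  - split.
    + by move=> x _; have [] := dF x.
    + by apply: cvg_at_right_filter; exact: cF.
    + by apply: cvg_at_left_filter; exact: cF.
  - by move=> x _; rewrite derive1E; have [_ ->] := dF x.
have FF0 : (F n.+1%:R - F (- n.+1%:R))%:E @[n --> \oo] --> (0%:E : \bar R).
  apply: cvg_EFin; first exact: nearW.
  by rewrite -(subr0 0); apply: cvgB.
have mf := measurable_int _ intf.
suff : (\int[lebesgue_measure]_x f_ n x)%E @[n --> \oo] -->
    (\int[lebesgue_measure]_x (f x)%:E)%E.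
  by under eq_fun do rewrite FTC; move=> H; exact: cvg_unique H FF0.
apply: (@dominated_cvg _ _ _ lebesgue_measure setT measurableT f_
  (fun x => (f x)%:E) (fun x => `|(f x)%:E|%E)) => //.
- move=> n; apply/measurable_EFinP/measurable_funM; first exact/measurable_EFinP.
  by apply: measurable_indic; exact: measurable_itv.
- move=> x _; apply: cvg_near_cst.
  exists (Num.truncn `|x|) => // n /= xn; rewrite /f_ indicE mem_set ?mulr1//.
  rewrite /I /= in_itv/= -ler_norml ltW// (lt_le_trans (truncnS_gt _))//.
  by rewrite ler_nat.
- exact: integrable_abse.
- move=> n x _; rewrite /f_ /= lee_fin indicE.
  by case: (_ \in _); rewrite (mulr1, mulr0)// normr0.
Qed.

Lemma normal_pdf0E (R : realType) (s : R) : s != 0 ->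
  normal_pdf 0 s = fun x => normal_peak s * expR (- x ^+ 2 / (s ^+ 2 *+ 2)).
Proof.
move=> s0; rewrite normal_pdfE//; apply/funext => x; by rewrite /normal_fun subr0.
Qed.

Lemma is_derive_normal_pdf (R : realType) (s x : R) : s != 0 ->
  is_derive x (1 : R) (normal_pdf 0 s) (- x / s ^+ 2 * normal_pdf 0 s x).
Proof.
move=> s0; rewrite normal_pdf0E//.
pose q (y : R) := - y ^+ 2 / (s ^+ 2 *+ 2).
have dq : is_derive x (1 : R) q (- x / s ^+ 2).
  have -> : q = (- (s ^+ 2 *+ 2)^-1) *: (id ^+ 2 : R -> R).
    by apply/funext => y; rewrite /q [RHS]/= mulNr mulrC -mulNr.
  apply: is_derive_eq.
  rewrite -[LHS]/(- (s ^+ 2 *+ 2)^-1 * (2 * x ^+ 1 * 1)) expr1 mulr1 -mulr_natr.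
  by rewrite invfM !mulNr -mulrA (mulrA 2^-1) mulVf ?mul1r ?pnatr_eq0// mulrC.
have -> : (fun x => normal_peak s * expR (- x ^+ 2 / (s ^+ 2 *+ 2))) =
    normal_peak s *: (expR \o q) by [].
apply: is_derive_eq.
by rewrite /GRing.scale/= /q; ring.
Qed.

(** A quadratic factor is absorbed by doubling the standard deviation.  This gives
at once the integrability and the decay of everything that is integrated against
the normal density below. *)
Lemma sqr_normal_pdf_le (R : realType) (s : R) : s != 0 ->
  exists2 K : R, 0 <= K &
    forall x, x ^+ 2 * normal_pdf 0 s x <= K * normal_pdf 0 (2 * s) x.
Proof.
move=> s0; have s2 : 2 * s != 0 by rewrite mulf_neq0 ?pnatr_eq0.
have ss : 0 < s ^+ 2 by rewrite exprn_even_gt0.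
exists (normal_peak s * (8 * s ^+ 2) / normal_peak (2 * s)).
  by rewrite divr_ge0 ?normal_peak_ge0// mulr_ge0 ?normal_peak_ge0// mulr_ge0// ltW.
move=> x; rewrite !normal_pdf0E//.
rewrite -[leRHS]mulrA (mulrA (normal_peak (2 * s))^-1) mulVf; last first.
  by rewrite gt_eqF// normal_peak_gt0.
rewrite mul1r mulrCA -[leRHS]mulrA ler_wpM2l ?normal_peak_ge0//.
(* In terms of z the two exponents are - 4 z and - z, and z exp(- z) <= 1. *)
pose z := x ^+ 2 / (8 * s ^+ 2).
have z0 : 0 <= z by rewrite divr_ge0 ?sqr_ge0// mulr_ge0// ltW.
have xE : x ^+ 2 = 8 * s ^+ 2 * z.
  by rewrite /z mulrC divfK// mulf_neq0 ?pnatr_eq0// gt_eqF.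
have -> : - x ^+ 2 / (s ^+ 2 *+ 2) = - z *+ 4.
  by rewrite xE; field.
have -> : - x ^+ 2 / ((2 * s) ^+ 2 *+ 2) = - z.
  by rewrite xE; field.
rewrite xE -[leLHS]mulrA ler_wpM2l//; first by rewrite mulr_ge0// ltW.
have ez : z * expR (- z) <= 1.
  rewrite -[leRHS](expRxMexpNx_1 z) ler_wpM2r ?expR_ge0//.
  by rewrite (le_trans _ (expR_ge1Dx z))// lerDr.
rewrite -mulr_natl expRM_natl exprS mulrA (le_trans (ler_wpM2r _ ez)) ?exprn_ge0 ?expR_ge0//.
rewrite mul1r -[leRHS]expr1 ler_wiXn2l ?expR_ge0//.
by rewrite -expR0 ler_expR oppr_le0.
Qed.

Lemma integrable_mul_normal_pdf (R : realType) (s : R) (f : R -> R) (C : R) :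
  s != 0 -> measurable_fun setT f -> (forall x, `|f x| <= C * (1 + x ^+ 2)) ->
  lebesgue_measure.-integrable setT (fun x => (f x * normal_pdf 0 s x)%:E).
Proof.
move=> s0 mf fC; have [K K0 xK] := sqr_normal_pdf_le s0.
have C0 : 0 <= C.
  have := le_trans (normr_ge0 _) (fC 0).
  by rewrite expr0n addr0 mulr1.
have ip (t : R) : lebesgue_measure.-integrable setT (EFin \o normal_pdf 0 t).
  exact: integrable_normal_pdf.
apply: (@le_integrable _ _ _ lebesgue_measure setT measurableT _
  (fun x => (C%:E * ((normal_pdf 0 s x)%:E + K%:E * (normal_pdf 0 (2 * s) x)%:E))%E)).
- apply/measurable_EFinP/measurable_funM => //.
  exact: measurable_normal_pdf.
- move=> x _; rewrite /= lee_fin.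
  rewrite normrM (ger0_norm (normal_pdf_ge0 _ _ _)) [leRHS]ger0_norm; last first.
    by rewrite mulr_ge0// addr_ge0// ?mulr_ge0// normal_pdf_ge0.
  rewrite (le_trans (ler_wpM2r _ (fC x)))// ?normal_pdf_ge0//.
  by rewrite -mulrA ler_wpM2l// mulrDl mul1r lerD2l.
- apply: integrableZl => //; apply: integrableD => //; first exact: ip.
  by apply: integrableZl => //; exact: ip.
Qed.

Lemma normal_pdf_vanish (R : realType) (s : R) (g : R -> R) (C : R) (e : nat -> R) :
  s != 0 -> (forall x, `|g x| <= C * (1 + `|x|)) ->
  (forall n, `|e n| = n.+1%:R) ->
  g (e n) * normal_pdf 0 s (e n) @[n --> \oo] --> 0.
Proof.
move=> s0 gC en; have [K K0 xK] := sqr_normal_pdf_le s0.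
have s2 : 2 * s != 0 by rewrite mulf_neq0 ?pnatr_eq0.
have C0 : 0 <= C.
  have := le_trans (normr_ge0 _) (gC 0).
  by rewrite normr0 addr0 mulr1.
pose D := C * 2 * K * normal_peak (2 * s).
have bound n : `|g (e n) * normal_pdf 0 s (e n)| <= D * n.+1%:R^-1.
  rewrite normrM (ger0_norm (normal_pdf_ge0 _ _ _)).
  have n0 : 0 < n.+1%:R :> R by [].
  rewrite ler_pdivlMr// mulrC mulrA.
  have : n.+1%:R * `|g (e n)| <= C * 2 * (e n) ^+ 2.
    rewrite -(real_normK (num_real (e n))) (le_trans (ler_wpM2l (ltW n0) (gC _)))//.
    rewrite en (_ : C * 2 * _ ^+ 2 = n.+1%:R * (C * (n.+1%:R + n.+1%:R))); last by ring.
    by rewrite !ler_wpM2l// ?lerD2r ?ler1n// ltW.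
  move=> /(ler_wpM2r (normal_pdf_ge0 0 s (e n)))/le_trans; apply.
  rewrite /D -[leLHS]mulrA -[leRHS]mulrA ler_wpM2l ?mulr_ge0// (le_trans (xK _))//.
  by rewrite ler_wpM2l// normal_pdf_ub.
apply: norm_cvg0; apply: (@squeeze_cvgr _ _ _ _ (fun=> 0) (fun n => D * n.+1%:R^-1)).
- by apply: nearW => n; rewrite normr_ge0 bound.
- exact: cvg_cst.
- by rewrite -(mulr0 D); apply: cvgM; [exact: cvg_cst|exact: cvg_harmonic].
Qed.

(** Stein's identity E (Z g(Z)) = s^2 E g'(Z): the derivative of g times the normal
density is (g' - x g / s^2) times the density, and its integral vanishes. *)
Lemma normal_stein (R : realType) (s : R) (g g' : R -> R) (C : R) :
  s != 0 -> (forall x : R, is_derive x (1 : R) g (g' x)) -> continuous g' ->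
  (forall x, `|g x| <= C * (1 + `|x|)) -> (forall x, `|g' x| <= C) ->
  \int[lebesgue_measure]_x (x * g x * normal_pdf 0 s x) =
  s ^+ 2 * \int[lebesgue_measure]_x (g' x * normal_pdf 0 s x).
Proof.
move=> s0 dg cg' gC g'C.
have s20 : s ^+ 2 != 0 by rewrite expf_neq0.
have C0 : 0 <= C by exact: le_trans (g'C 0).
have cg : continuous g.
  by move=> x; apply/differentiable_continuous/derivable1_diffP; have [] := dg x.
have ig' : lebesgue_measure.-integrable setT
    (fun x : R => (g' x * normal_pdf 0 s x)%:E).
  apply: (@integrable_mul_normal_pdf _ _ _ C) => //.
    exact: continuous_measurable_fun.
  by move=> x; rewrite (le_trans (g'C x))// ler_peMr// lerDl sqr_ge0.
have ig : lebesgue_measure.-integrable setT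
    (fun x : R => (x * g x * normal_pdf 0 s x)%:E).
  apply: (@integrable_mul_normal_pdf _ _ _ (C *+ 2)) => //.
    by apply: measurable_funM => //; exact: continuous_measurable_fun.
  move=> x; rewrite normrM (le_trans (ler_wpM2l _ (gC x)))//.
  rewrite mulrCA mulrnAl -mulrnAr ler_wpM2l// -(real_normK (num_real x)).
  by have := sqr_ge0 (`|x| - 1); nra.
have igs := integrableZl measurableT (s ^+ 2)^-1 ig.
(* The derivative of g times the density. *)
pose f x := g' x * normal_pdf 0 s x - (s ^+ 2)^-1 * (x * g x * normal_pdf 0 s x).
have cp := @continuous_normal_pdf R 0 s s0.
have H : (\int[lebesgue_measure]_x (f x)%:E)%E = 0%E.
  apply: (@integral_derive_eq0 _ (g * normal_pdf 0 s)).
  - move=> x; have dp := is_derive_normal_pdf x s0.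
    apply: is_derive_eq.
    rewrite /f -[X in X + _ = _]/(g x * (- x / s ^+ 2 * normal_pdf 0 s x)).
    by rewrite -[X in _ + X = _]/(normal_pdf 0 s x * g' x); ring.
  - move=> x; apply: cvgB; first by apply: cvgM; [exact: cg'|exact: cp].
    apply: cvgM; first exact: cvg_cst.
    apply: cvgM; last exact: cp.
    by apply: cvgM; [exact: cvg_id|exact: cg].
  - exact: (integrableB measurableT ig' igs).
  - by apply: (normal_pdf_vanish s0 gC) => n; rewrite normr_nat.
  - by apply: (normal_pdf_vanish s0 gC) => n; rewrite normrN normr_nat.
move/(congr1 fine) : H; rewrite -/(Rintegral _ _ _) RintegralB//.
rewrite RintegralZl// => /eqP; rewrite subr_eq0 => /eqP ->.
by rewrite mulVKf.
Qed.

(** Stein's identity for the identity function. *)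
Lemma integral_sqr_normal_pdf (R : realType) (s : R) : s != 0 ->
  (\int[lebesgue_measure]_x (x ^+ 2 * normal_pdf 0 s x)%:E)%E = (s ^+ 2)%:E.
Proof.
move=> s0.
have H := @normal_stein R s id (fun=> 1) 1 s0.
rewrite -[LHS]fineK; last first.
  apply: integrable_fin_num => //.
  apply: (@integrable_mul_normal_pdf _ _ _ 1) => //.
  by move=> x; rewrite mul1r ger0_norm ?sqr_ge0// lerDr.
congr EFin; rewrite -/(Rintegral _ _ _).
under eq_Rintegral do rewrite expr2.
rewrite H.
- under eq_Rintegral do rewrite mul1r.
  by rewrite /Rintegral integral_normal_pdf mulr1.
- by move=> x; exact: cvg_cst.
- by move=> x; rewrite mul1r lerDr.
- by move=> x; rewrite normr1.
Qed.

Lemma measurable_cos (R : realType) : measurable_fun setT (@cos R).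
Proof. by apply: continuous_measurable_fun; exact: continuous_cos. Qed.

Lemma measurable_sin (R : realType) : measurable_fun setT (@sin R).
Proof. by apply: continuous_measurable_fun; exact: continuous_sin. Qed.

(** Stein's identity for x |-> sin (t x) says that c(t) = E cos(t Z) satisfies
c' = - t s^2 c; hence c(t) exp(t^2 s^2 / 2) is constant. *)
Lemma integral_cos_normal_pdf (R : realType) (s : R) : s != 0 ->
  \int[lebesgue_measure]_x (cos x * normal_pdf 0 s x) = expR (- (s ^+ 2 / 2)).
Proof.
move=> s0.
pose c (t : R) := \int[lebesgue_measure]_x (cos (t * x) * normal_pdf 0 s x).
have le1 (x : R) : 1 <= 1 * (1 + x ^+ 2) by rewrite mul1r lerDl sqr_ge0.
have dcos (t x : R) :
    is_derive t (1 : R) (fun t => cos (t * x) * normal_pdf 0 s x)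
      (- (x * sin (t * x) * normal_pdf 0 s x)).
  have -> : (fun t => cos (t * x) * normal_pdf 0 s x) =
      normal_pdf 0 s x *: (cos \o (x *: (id : R -> R))).
    by apply/funext => u; rewrite /GRing.scale/= mulrC (mulrC u).
  apply: is_derive_eq.
  rewrite -[LHS]/(normal_pdf 0 s x * (- sin (x * t) * (x * 1))) (mulrC x t).
  by ring.
have icos (t : R) : lebesgue_measure.-integrable setT
    (fun x : R => (cos (t * x) * normal_pdf 0 s x)%:E).
  apply: (@integrable_mul_normal_pdf _ _ _ 1) => //.
    by apply: measurableT_comp; [exact: measurable_cos|exact: measurable_funM].
  by move=> x; rewrite (le_trans _ (le1 x))// ler_norml cos_geN1 cos_le1.
have dc (t : R) : is_derive t (1 : R) c (- (t * s ^+ 2 * c t)).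
  have It : [set` `]t - 1, t + 1[] t.
    by rewrite /= in_itv/= ltrBlDr ltrDl ltr01.
  have df (u x : R) : partial1of2 (fun t x => cos (t * x) * normal_pdf 0 s x) u x
      = - (x * sin (u * x) * normal_pdf 0 s x).
    by rewrite partial1of2E; have [_ ->] := dcos u x.
  have intG : lebesgue_measure.-integrable setT
      (EFin \o (fun x => `|x| * normal_pdf 0 s x)).
    apply: (@integrable_mul_normal_pdf _ _ _ 1) => //.
    move=> x; rewrite normr_id mul1r -(real_normK (num_real x)).
    by have := sqr_ge0 (`|x| - 1); nra.
  have G0 (x : R) : 0 <= `|x| * normal_pdf 0 s x.
    by rewrite mulr_ge0// normal_pdf_ge0.
  have Gub (u x : R) :
      `|partial1of2 (fun t x => cos (t * x) * normal_pdf 0 s x) u x| <=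
      `|x| * normal_pdf 0 s x.
    rewrite df normrN normrM (ger0_norm (normal_pdf_ge0 _ _ _)).
    rewrite ler_wpM2r ?normal_pdf_ge0// normrM ler_piMr//.
    by rewrite ler_norml sin_geN1 sin_le1.
  have derf (u x : R) : derivable (fun t : R => cos (t * x) * normal_pdf 0 s x) u (1 : R).
    by have [] := dcos u x.
  (* |x| times the density dominates the derivative in t, uniformly in t. *)
  apply: DeriveDef.
    exact: (@derivable_under_integral _ _ _ lebesgue_measure _ setT measurableT
      t (t - 1) (t + 1) It (fun u _ => icos u) (fun u x _ _ => derf u x)
      _ G0 intG (fun u x _ _ => Gub u x)).
  rewrite -derive1E.
  rewrite (@differentiation_under_integral _ _ _ lebesgue_measure _ setT measurableT
      t (t - 1) (t + 1) It (fun u _ => icos u) (fun u x _ _ => derf u x)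
      _ G0 intG (fun u x _ _ => Gub u x)).
  under eq_Rintegral do rewrite df -mulN1r.
  have isin : lebesgue_measure.-integrable setT
      (fun x : R => (x * sin (t * x) * normal_pdf 0 s x)%:E).
    apply: (@integrable_mul_normal_pdf _ _ _ 1) => //.
      apply: measurable_funM => //.
      by apply: measurableT_comp; [exact: measurable_sin|exact: measurable_funM].
    move=> x; rewrite mul1r -(real_normK (num_real x)) normrM.
    have : `|sin (t * x)| <= 1 by rewrite ler_norml sin_geN1 sin_le1.
    by move=> /(ler_wpM2l (normr_ge0 x)); have := sqr_ge0 (`|x| - 1); nra.
  have dsin (x : R) : is_derive x (1 : R) (fun x => sin (t * x)) (t * cos (t * x)).
    have -> : (fun x => sin (t * x)) = sin \o (t *: (id : R -> R)) by [].
    apply: is_derive_eq.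
    by rewrite -[LHS]/(cos (t * x) * (t * 1)) mulr1 mulrC.
  rewrite RintegralZl// (@normal_stein _ _ (fun x => sin (t * x))
    (fun x => t * cos (t * x)) (`|t| + 1) s0 dsin)//.
  - under eq_Rintegral do rewrite -mulrA.
    rewrite mulN1r [in LHS]RintegralZl//; last exact: icos.
    by rewrite mulrCA mulrA.
  - move=> x; apply: cvgM; first exact: cvg_cst.
    apply: (cvg_comp (fun x : R => t * x) cos); last exact: continuous_cos.
    by apply: cvgM; [exact: cvg_cst|exact: cvg_id].
  - move=> x; have : `|sin (t * x)| <= 1 by rewrite ler_norml sin_geN1 sin_le1.
    by move/le_trans; apply; have := normr_ge0 t; have := normr_ge0 x; nra.
  - move=> x; have : `|cos (t * x)| <= 1 by rewrite ler_norml cos_geN1 cos_le1.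
    move=> /(ler_wpM2l (normr_ge0 t)); rewrite normrM mulr1 => /le_trans; apply.
    by rewrite lerDl.
(* The differential equation says that H is constant, and H(0) = 1. *)
pose H : R -> R := fun t => c t * expR (t ^+ 2 * (s ^+ 2 / 2)).
have dH (t : R) : is_derive t (1 : R) H 0.
  have -> : H = c * (expR \o ((s ^+ 2 / 2) *: (id ^+ 2 : R -> R))).
    by apply/funext => u; rewrite /H mulrC [in LHS]mulrC [in X in expR X]mulrC.
  have dct := dc t.
  apply: is_derive_eq.
  rewrite -[LHS]/(c t * (expR (s ^+ 2 / 2 * t ^+ 2) * (s ^+ 2 / 2 * ((2%:R * t ^+ 1) * 1))) +
    expR (s ^+ 2 / 2 * t ^+ 2) * (- (t * s ^+ 2 * c t))).
  by field.
have := is_derive_0_is_cst 1 0 dH.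
rewrite /H expr1n mul1r expr0n mul0r expR0 mulr1.
have -> : c 0 = 1.
  rewrite /c; under eq_Rintegral do rewrite mul0r cos0 mul1r.
  by rewrite /Rintegral integral_normal_pdf.
move=> c1; transitivity (c 1).
  by apply: eq_Rintegral => x _; rewrite mul1r.
apply: (@mulIf _ (expR (s ^+ 2 / 2))); first by rewrite gt_eqF ?expR_gt0.
by rewrite c1 -expRD addNr expR0.
Qed.

(** * Integrals determined by their values on indicators *)

Lemma measurable_indic_comp d1 (T1 : measurableType d1) d (T : measurableType d)
    (R : realType) (Y : T1 -> T) (E : set T) :
  measurable_fun setT Y -> measurable E ->
  measurable_fun setT (fun x => \1_E (Y x) : R).
Proof.
move=> mY mE; apply: (@measurable_indic _ T1 R setT (Y @^-1` E)).
by rewrite -[X in measurable X]setTI; exact: mY.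
Qed.

Section WeightedIntegral.
Local Open Scope ereal_scope.
Context d1 (T1 : measurableType d1) d (T : measurableType d) (R : realType).
Context (mu : {measure set T1 -> \bar R}) (Y : T1 -> T) (W : T1 -> R).
Hypothesis mY : measurable_fun setT Y.
Hypothesis mW : measurable_fun setT W.
Hypothesis W0 : forall x, (0 <= W x)%R.

Import HBNNSimple.

(** On simple functions the integral against the weight [W] only sees the set
function sending E to the integral of [W] over the preimage of E by [Y]. *)
Lemma integral_weighted_nnsfun (h : {nnsfun T >-> R}) :
  \int[mu]_x (h (Y x) * W x)%:E =
  \sum_(r \in range h) (r%:E * \int[mu]_x (\1_(h @^-1` [set r]) (Y x) * W x)%:E).
Proof.
have mi r : measurable_fun setT (fun x => (\1_(h @^-1` [set r]) (Y x) * W x)%R).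
  apply: measurable_funM => //.
  exact: measurable_indic_comp.
transitivity (\int[mu]_x (\sum_(r \in range h)
    (r%:E * (\1_(h @^-1` [set r]) (Y x) * W x)%:E))).
  apply: eq_integral => x _; rewrite {1}(fimfunE h) EFinM -fsumEFin//.
  rewrite ge0_mule_fsuml; last by move=> r; exact: nnfun_muleindic_ge0.
  by apply: eq_fsbigr => r _; rewrite -!EFinM mulrA.
rewrite ge0_integral_fsum//.
- apply: eq_fsbigr => r /set_mem[y _ <-].
  rewrite ge0_integralZl//; [exact/measurable_EFinP|by move=> x _; rewrite lee_fin mulr_ge0|].
  by rewrite lee_fin.
- by move=> r; apply: emeasurable_funM => //; exact/measurable_EFinP.
- move=> r x _; rewrite -EFinM mulrA EFinM mule_ge0 ?lee_fin//.
  by rewrite -lee_fin; exact: nnfun_muleindic_ge0.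
Qed.

Lemma cvg_integral_weighted (f : T -> R)
    (mf : measurable_fun setT (EFin \o f)) :
  (forall y, 0 <= f y)%R ->
  (\int[mu]_x ((nnsfun_approx measurableT mf n) (Y x) * W x)%:E) @[n --> \oo]
  --> \int[mu]_x (f (Y x) * W x)%:E.
Proof.
move=> f0; pose h := nnsfun_approx measurableT mf.
(* Monotone convergence along the simple approximations of f. *)
have -> : \int[mu]_x (f (Y x) * W x)%:E =
    \int[mu]_x (limn (fun n => (h n (Y x) * W x)%:E)).
  apply: eq_integral => x _; apply/esym/cvg_lim => //.
  rewrite EFinM; under eq_fun do rewrite EFinM.
  apply: cvgeZr => //.
  by apply: (@cvg_nnsfun_approx _ _ _ _ measurableT _ mf) => // y _; rewrite lee_fin.
apply: cvg_monotone_convergence => //.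
- move=> n; apply/measurable_EFinP/measurable_funM => //.
  exact: measurableT_comp.
- by move=> n x _; rewrite lee_fin mulr_ge0.
- move=> x _ m n mn; rewrite lee_fin ler_wpM2r//.
  exact/lefP/nd_nnsfun_approx.
Qed.

End WeightedIntegral.

Section EqIntegralWeighted.
Import HBNNSimple.

(** This covers both the passage from a law to its density (one weight is the
density, the other is 1) and the factorization of expectations under
independence. *)
Lemma eq_integral_weighted d1 (T1 : measurableType d1) d2 (T2 : measurableType d2)
    d (T : measurableType d) (R : realType)
    (mu1 : {measure set T1 -> \bar R}) (Y1 : T1 -> T) (W1 : T1 -> R)
    (mu2 : {measure set T2 -> \bar R}) (Y2 : T2 -> T) (W2 : T2 -> R) (f : T -> R) :
  measurable_fun setT Y1 -> measurable_fun setT W1 -> (forall x, 0 <= W1 x) ->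
  measurable_fun setT Y2 -> measurable_fun setT W2 -> (forall x, 0 <= W2 x) ->
  (forall E, measurable E ->
    \int[mu1]_x (\1_E (Y1 x) * W1 x)%:E = \int[mu2]_x (\1_E (Y2 x) * W2 x)%:E)%E ->
  measurable_fun setT f -> (forall y, 0 <= f y) ->
  (\int[mu1]_x (f (Y1 x) * W1 x)%:E = \int[mu2]_x (f (Y2 x) * W2 x)%:E)%E.
Proof.
move=> mY1 mW1 W10 mY2 mW2 W20 H mf f0.
have mEf : measurable_fun setT (EFin \o f) by exact/measurable_EFinP.
have := @cvg_integral_weighted _ _ _ _ _ mu2 _ _ mY2 mW2 W20 f mEf f0.
have := @cvg_integral_weighted _ _ _ _ _ mu1 _ _ mY1 mW1 W10 f mEf f0.
rewrite (_ : (fun n => _) = (fun n => \int[mu2]_x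
    ((nnsfun_approx measurableT mEf n) (Y2 x) * W2 x)%:E)%E); last first.
  apply/funext => n; rewrite !integral_weighted_nnsfun//.
  by apply: eq_fsbigr => r _; rewrite H.
by move=> h1 h2; exact: cvg_unique h1 h2.
Qed.

End EqIntegralWeighted.

Section BoundedExpectation.
Context d (T : measurableType d) (R : realType) (P : probability T R).
Implicit Types f g : T -> R.

Definition bounded_measurable f :=
  measurable_fun setT f /\ exists M : R, forall x, `|f x| <= M.

Lemma bounded_measurable_integrable f :
  bounded_measurable f -> P.-integrable setT (EFin \o f).
Proof.
move=> [mf [M fM]].
apply: (@le_integrable _ _ _ P setT measurableT _ (fun x => `|M|%:E)).
- exact/measurable_EFinP.
- move=> x _; by rewrite /= lee_fin normr_id (le_trans (fM x))// ler_norm.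
- exact: finite_measure_integrable_cst.
Qed.

Lemma bounded_measurable_cst (r : R) : bounded_measurable (fun=> r).
Proof. by split; [exact: measurable_cst|exists `|r|]. Qed.

Lemma bounded_measurableD f g :
  bounded_measurable f -> bounded_measurable g ->
  bounded_measurable (fun x => f x + g x).
Proof.
move=> [mf [M fM]] [mg [N gN]]; split; first exact: measurable_funD.
by exists (M + N) => x; rewrite (le_trans (ler_normD _ _))// lerD.
Qed.

Lemma bounded_measurableM f g :
  bounded_measurable f -> bounded_measurable g ->
  bounded_measurable (fun x => f x * g x).
Proof.
move=> [mf [M fM]] [mg [N gN]]; split; first exact: measurable_funM.
by exists (M * N) => x; rewrite normrM ler_pM.
Qed.

Lemma bounded_measurableZ (r : R) f :
  bounded_measurable f -> bounded_measurable (fun x => r * f x).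
Proof. exact/bounded_measurableM/bounded_measurable_cst. Qed.

Lemma bounded_measurable_indic_comp d' (T' : measurableType d') (Y : T -> T')
    (E : set T') : measurable_fun setT Y -> measurable E ->
  bounded_measurable (fun x => \1_E (Y x)).
Proof.
move=> mY mE; split; first exact: measurable_indic_comp.
by exists 1 => x; rewrite indicE; case: (_ \in _); rewrite (normr1, normr0).
Qed.

Lemma bounded_measurable_cos f :
  measurable_fun setT f -> bounded_measurable (fun x => cos (f x)).
Proof.
move=> mf; split; first by apply: measurableT_comp mf; exact: measurable_cos.
by exists 1 => x; rewrite ler_norml cos_geN1 cos_le1.
Qed.

Lemma bounded_measurable_sin f :
  measurable_fun setT f -> bounded_measurable (fun x => sin (f x)).
Proof.
move=> mf; split; first by apply: measurableT_comp mf; exact: measurable_sin.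
by exists 1 => x; rewrite ler_norml sin_geN1 sin_le1.
Qed.

Lemma expectationD f g : bounded_measurable f -> bounded_measurable g ->
  \int[P]_x (f x + g x) = \int[P]_x f x + \int[P]_x g x.
Proof.
by move=> /bounded_measurable_integrable ? /bounded_measurable_integrable ?;
  rewrite RintegralD.
Qed.

Lemma expectationZ (r : R) f : bounded_measurable f ->
  \int[P]_x (r * f x) = r * \int[P]_x f x.
Proof. by move=> /bounded_measurable_integrable ?; rewrite RintegralZl. Qed.

Lemma expectation_cst (r : R) : \int[P]_x r = r.
Proof.
by rewrite Rintegral_cst//= probability_setT mulr1.
Qed.

Lemma expectation_indic d' (T' : measurableType d') (Y : T -> T')
    (E : set T') : measurable_fun setT Y -> measurable E ->
  (\int[P]_x \1_E (Y x))%:E = P [set x | E (Y x)].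
Proof.
move=> mY mE; have mYE : measurable [set x | E (Y x)].
  by rewrite -[X in measurable X]setTI; exact: mY.
rewrite /Rintegral -[RHS]fineK ?fin_num_measure//; congr (fine _)%:E.
rewrite -[X in P X]setIT -integral_indic//.
Qed.

Lemma cvg_expectation (f_ : nat -> T -> R) (f : T -> R) (M : R) :
  (forall n, measurable_fun setT (f_ n)) -> (forall n x, `|f_ n x| <= M) ->
  (forall x, f_ n x @[n --> \oo] --> f x) ->
  bounded_measurable f /\ \int[P]_x f_ n x @[n --> \oo] --> \int[P]_x f x.
Proof.
move=> mf fM ff.
have bf : bounded_measurable f.
  split; first by apply: (measurable_fun_cvg mf) => x _; exact: ff.
  exists M => x; have nf : `|f_ n x| @[n --> \oo] --> `|f x| by apply: cvg_norm; exact: ff.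
  rewrite -(cvg_lim _ nf)//; apply: limr_le; first by apply/cvg_ex; eexists; exact: nf.
  by apply: nearW => n; exact: fM.
split => //.
have H : (\int[P]_x (f_ n x)%:E @[n --> \oo] --> \int[P]_x (f x)%:E)%E.
  apply: (@dominated_cvg _ _ _ P setT measurableT (fun n x => (f_ n x)%:E)
    (fun x => (f x)%:E) (fun=> M%:E)) => //.
  - by move=> n; exact/measurable_EFinP.
  - by move=> x _; apply: cvg_EFin; [exact: nearW|exact: ff].
  - exact: finite_measure_integrable_cst.
  - by move=> n x _; rewrite /= lee_fin.
apply: fine_cvg; rewrite fineK//.
exact/integrable_fin_num/bounded_measurable_integrable.
Qed.

End BoundedExpectation.

(** * Bounded polynomial approximation of a step *)

(** The second factor tends to 1 for v > 0 and to 0 for v < 0, as s = (1 - v) / 2 is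
then below or above 1/2 and 2^n s^n tends to 0 or to infinity.  At v = 0 it tends
to exp(-1); the first factor, which tends to 1 for v <> 0, is there to give the
value 0. *)
Definition step_poly (R : realFieldType) (n : nat) (v : R) : R :=
  (1 - (1 - v ^+ 2) ^+ n) * (1 - ((1 - v) / 2) ^+ n) ^+ (2 ^ n).

Lemma bernoulli_ineq (R : realFieldType) (n : nat) (y : R) : 0 <= y <= 1 ->
  1 - n%:R * y <= (1 - y) ^+ n /\ (1 - y) ^+ n * (1 + n%:R * y) <= 1.
Proof.
move=> /andP[y0 y1]; have z0 : 0 <= 1 - y by rewrite subr_ge0.
elim: n => [|n [IH1 IH2]]; first by rewrite mul0r subr0 addr0 expr0 mulr1.
have n0 : 0 <= n%:R :> R by [].
have p0 : 0 <= (1 - y) ^+ n by exact: exprn_ge0.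
rewrite exprS -natr1; split.
  have := ler_wpM2l z0 IH1; have := mulr_ge0 n0 (sqr_ge0 y); nra.
rewrite (le_trans _ IH2)// -mulrA mulrCA ler_wpM2l//.
have := mulr_ge0 n0 (sqr_ge0 y); have := sqr_ge0 y; nra.
Qed.

Lemma step_poly_bound (R : realFieldType) (n : nat) (v : R) : `|v| <= 1 ->
  `|step_poly n v| <= 1.
Proof.
move=> v1; have v2 : 0 <= v ^+ 2 <= 1.
  by rewrite sqr_ge0 -(real_normK (num_real v)) exprn_ile1.
have {}v2 : 0 <= 1 - v ^+ 2 <= 1 by lra.
have vh : 0 <= (1 - v) / 2 <= 1 by move: v1; rewrite ler_norml; lra.
have pw (u : R) k : 0 <= u <= 1 -> 0 <= u ^+ k <= 1.
  by move=> /andP[u0 u1]; rewrite exprn_ge0// exprn_ile1.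
have := pw _ n v2; have := pw _ n vh.
set a := _ ^+ n => a01; set b := _ ^+ n => b01.
have {}a01 : 0 <= 1 - a <= 1 by lra.
have := pw _ (2 ^ n)%N a01; rewrite /step_poly -/a -/b.
set c := _ ^+ (2 ^ n) => c01.
by rewrite ger0_norm; nra.
Qed.

Lemma cvg_step_poly (R : realType) (v : R) : `|v| <= 1 ->
  step_poly n v @[n --> \oo] --> ((0 < v)%R%:R : R).
Proof.
move=> v1; have [->|v0] := eqVneq v 0.
  rewrite ltxx /step_poly expr0n subr0/=.
  under eq_fun do rewrite expr1n subrr mul0r.
  exact: cvg_cst.
have H1 : 1 - (1 - v ^+ 2) ^+ n @[n --> \oo] --> (1 : R).
  rewrite -[X in _ --> X]subr0; apply: cvgB; first exact: cvg_cst.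
  apply: cvg_expr; have : 0 < v ^+ 2 <= 1.
    by rewrite exprn_even_gt0 ?v0//= -(real_normK (num_real v)) exprn_ile1 ?orbT.
  by move=> v2; rewrite ger0_norm; lra.
rewrite -[X in _ --> X]mul1r; apply: cvgM => //.
have vh : 0 <= (1 - v) / 2 <= 1 by move: v1; rewrite ler_norml; lra.
set s : R := (1 - v) / 2 in vh *.
have sn n : 0 <= s ^+ n <= 1.
  by case/andP: vh => s0 s1; rewrite exprn_ge0// exprn_ile1.
(* The two inequalities bound the power by 1 - (2 s)^n from below and by
   1 / (2 s)^n from above. *)
have B n := bernoulli_ineq (2 ^ n) (sn n).
have E n : (2 ^ n)%:R * s ^+ n = (2 * s) ^+ n by rewrite natrX -exprMn.
have [vp|vn] := ltP 0 v.
  apply: (@squeeze_cvgr _ _ _ _ (fun n => 1 - (2 * s) ^+ n) (fun=> 1)).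
  - apply: nearW => n; have [] := B n; rewrite E => -> _ /=.
    by rewrite exprn_ile1; have := sn n; lra.
  - rewrite -[X in _ --> X]subr0; apply: cvgB; first exact: cvg_cst.
    by apply: cvg_expr; rewrite ger0_norm /s; move: v1; rewrite ler_norml; lra.
  - exact: cvg_cst.
have vlt : v < 0 by rewrite lt_neqAle v0.
have ts : 1 < 2 * s by rewrite /s; lra.
apply: (@squeeze_cvgr _ _ _ _ (fun=> 0) (fun n => ((2 * s)^-1) ^+ n)).
- apply: nearW => n; rewrite exprn_ge0 ?andTb; last by have := sn n; lra.
  have [_] := B n; rewrite E exprVn.
  have p0 : 0 <= (1 - s ^+ n) ^+ (2 ^ n) by rewrite exprn_ge0//; have := sn n; lra.
  have q0 : 0 < (2 * s) ^+ n by rewrite exprn_gt0// (lt_trans _ ts).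
  rewrite mulrDr mulr1 => b1; rewrite -[leRHS]mul1r ler_pdivlMr//.
  by rewrite (le_trans _ b1)// lerDr.
- exact: cvg_cst.
- apply: cvg_expr; rewrite ger0_norm ?invr_ge0; last lra.
  by rewrite invf_lt1//; lra.
Qed.

(** The period of the sine eventually exceeds the distance from x to a. *)
Lemma cvg_gt0_sin (R : realType) (a x : R) :
  (0 < sin (n.+1%:R^-1 * (x - a)))%R%:R @[n --> \oo] --> ((a < x)%R%:R : R).
Proof.
apply: cvg_near_cst.
exists (Num.truncn `|x - a|) => // n /= xn; congr (_ %:R); congr nat_of_bool.
have n0 : 0 < n.+1%:R :> R by [].
have xan : `|x - a| < n.+1%:R.
  by rewrite (lt_le_trans (truncnS_gt _))// ler_nat.
have u1 : `|n.+1%:R^-1 * (x - a)| < 1.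
  by rewrite normrM ger0_norm// mulrC ltr_pdivrMr// mul1r.
have upi : `|n.+1%:R^-1 * (x - a)| < pi.
  by rewrite (lt_le_trans u1)// (le_trans _ (pi_ge2 R))// ler1n.
rewrite -[RHS]subr_gt0 -[RHS](pmulr_rgt0 (x - a) (_ : 0 < n.+1%:R^-1)) ?invr_gt0//.
move: upi; set u := _ * (x - a); rewrite ltr_norml => /andP[uN up].
have [u0|u0|->] := ltgtP u 0.
- apply/negbTE; rewrite -leNgt -oppr_ge0 -sinN sin_ge0_pi//.
  by rewrite oppr_ge0 ltW//= lerNl ltW.
- by rewrite sin_gt0_pi// u0.
- by rewrite sin0 ltxx.
Qed.

(** * Equality of laws from equality of characteristic functions *)

Section FourierTransfer.
Context d (Omega : measurableType d) (R : realType) (P : probability Omega R).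
Context (V : lmodType R) (X Y : V -> Omega -> R).
Hypothesis mX : forall v, measurable_fun setT (X v).
Hypothesis mY : forall v, measurable_fun setT (Y v).
Hypothesis linX : forall a u v w, X (a *: u + v) w = a * X u w + X v w.
Hypothesis linY : forall a u v w, Y (a *: u + v) w = a * Y u w + Y v w.
Hypothesis eq_cos : forall v, \int[P]_w cos (X v w) = \int[P]_w cos (Y v w).
Hypothesis eq_sin : forall v, \int[P]_w sin (X v w) = \int[P]_w sin (Y v w).
Implicit Types f g : Omega -> R.

Let linXD u v w : X (u + v) w = X u w + X v w.
Proof. by have := linX 1 u v w; rewrite scale1r mul1r. Qed.
Let linYD u v w : Y (u + v) w = Y u w + Y v w.
Proof. by have := linY 1 u v w; rewrite scale1r mul1r. Qed.
Let linXB u v w : X (u - v) w = X u w - X v w.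
Proof. by have := linX (-1) v u w; rewrite scaleN1r mulN1r addrC => ->; rewrite addrC. Qed.
Let linYB u v w : Y (u - v) w = Y u w - Y v w.
Proof. by have := linY (-1) v u w; rewrite scaleN1r mulN1r addrC => ->; rewrite addrC. Qed.
Let linXZ a u w : X (a *: u) w = a * X u w.
Proof.
have X0 : X 0 w = 0 by rewrite -(subrr (0 : V)) linXB subrr.
by have := linX a u 0 w; rewrite addr0 X0 addr0.
Qed.
Let linYZ a u w : Y (a *: u) w = a * Y u w.
Proof.
have Y0 : Y 0 w = 0 by rewrite -(subrr (0 : V)) linYB subrr.
by have := linY a u 0 w; rewrite addr0 Y0 addr0.
Qed.

(** The measures with densities f and g have images under X and Y whose Fourier
transforms agree, written without complex numbers. *)
Definition same_fourier f g := [/\ bounded_measurable f, bounded_measurable g &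
  forall v, \int[P]_w (f w * cos (X v w)) = \int[P]_w (g w * cos (Y v w)) /\
            \int[P]_w (f w * sin (X v w)) = \int[P]_w (g w * sin (Y v w))].

Lemma same_fourier1 : same_fourier (fun=> 1) (fun=> 1).
Proof.
split; [exact: bounded_measurable_cst|exact: bounded_measurable_cst|move=> v].
have E r : \int[P]_w (1 * r w) = \int[P]_w (r w).
  by apply: eq_Rintegral => w _; rewrite mul1r.
rewrite (E (fun w => cos (X v w))) (E (fun w => cos (Y v w))).
rewrite (E (fun w => sin (X v w))) (E (fun w => sin (Y v w))).
exact: (conj (eq_cos v) (eq_sin v)).
Qed.

Lemma same_fourier_lin (a b : R) f1 f2 g1 g2 :
  same_fourier f1 g1 -> same_fourier f2 g2 ->
  same_fourier (fun w => a * f1 w + b * f2 w) (fun w => a * g1 w + b * g2 w).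
Proof.
move=> [bf1 bg1 h1] [bf2 bg2 h2].
have lin (r s u : Omega -> R) : bounded_measurable r -> bounded_measurable s ->
    bounded_measurable u ->
    \int[P]_w ((a * r w + b * s w) * u w) =
    a * \int[P]_w (r w * u w) + b * \int[P]_w (s w * u w).
  move=> br bs bu.
  have bru := bounded_measurableM br bu; have bsu := bounded_measurableM bs bu.
  rewrite -!expectationZ// -expectationD; [|exact: bounded_measurableZ..].
  by apply: eq_Rintegral => w _; rewrite mulrDl !mulrA.
have bc (Z : V -> Omega -> R) v : measurable_fun setT (Z v) ->
    bounded_measurable (fun w => cos (Z v w)) by exact: bounded_measurable_cos.
have bs (Z : V -> Omega -> R) v : measurable_fun setT (Z v) ->
    bounded_measurable (fun w => sin (Z v w)) by exact: bounded_measurable_sin.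
split=> [||v].
- by apply: bounded_measurableD; exact: bounded_measurableZ.
- by apply: bounded_measurableD; exact: bounded_measurableZ.
- rewrite !lin//; [|by apply: bc || apply: bs..].
  by have [-> ->] := h1 v; have [-> ->] := h2 v.
Qed.

Lemma same_fourier_cvg (f_ g_ : nat -> Omega -> R) f g (M : R) :
  (forall n, same_fourier (f_ n) (g_ n)) ->
  (forall n w, `|f_ n w| <= M) -> (forall n w, `|g_ n w| <= M) ->
  (forall w, f_ n w @[n --> \oo] --> f w) ->
  (forall w, g_ n w @[n --> \oo] --> g w) ->
  same_fourier f g.
Proof.
move=> H fM gM ff gg.
have mf n : measurable_fun setT (f_ n) by have [[]] := H n.
have mg n : measurable_fun setT (g_ n) by have [_ []] := H n.
have [bf _] := cvg_expectation P mf fM ff.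
have [bg _] := cvg_expectation P mg gM gg.
have lim (r_ : nat -> Omega -> R) (r u : Omega -> R) :
    (forall n, measurable_fun setT (r_ n)) -> (forall n w, `|r_ n w| <= M) ->
    (forall w, r_ n w @[n --> \oo] --> r w) ->
    measurable_fun setT u -> (forall w, `|u w| <= 1) ->
    \int[P]_w (r_ n w * u w) @[n --> \oo] --> \int[P]_w (r w * u w).
  move=> mr rM rr mu u1.
  apply: (@cvg_expectation _ _ _ P (fun n w => r_ n w * u w) _ M _ _ _).2.
  - by move=> n; exact: measurable_funM.
  - by move=> n w; rewrite normrM -[M]mulr1 ler_pM.
  - by move=> w; apply: cvgM; [exact: rr|exact: cvg_cst].
have cosle (x : R) : `|cos x| <= 1 by rewrite ler_norml cos_geN1 cos_le1.
have sinle (x : R) : `|sin x| <= 1 by rewrite ler_norml sin_geN1 sin_le1.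
have mc (Z : V -> Omega -> R) v : measurable_fun setT (Z v) ->
    measurable_fun setT (fun w => cos (Z v w)).
  by move=> mZ; have [] := bounded_measurable_cos mZ.
have ms (Z : V -> Omega -> R) v : measurable_fun setT (Z v) ->
    measurable_fun setT (fun w => sin (Z v w)).
  by move=> mZ; have [] := bounded_measurable_sin mZ.
split=> // v; split.
- have := lim _ _ _ mf fM ff (mc _ _ (mX v)) (fun=> cosle _).
  under eq_fun => n do rewrite (let: And3 _ _ h := H n in (h v).1).
  by move/cvg_unique; apply => //; exact: (lim _ _ _ mg gM gg (mc _ _ (mY v))).
- have := lim _ _ _ mf fM ff (ms _ _ (mX v)) (fun=> sinle _).
  under eq_fun => n do rewrite (let: And3 _ _ h := H n in (h v).2).
  by move/cvg_unique; apply => //; exact: (lim _ _ _ mg gM gg (ms _ _ (mY v))).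
Qed.

(** By linearity of X, the product formulas for cos and sin express a multiple of
cos X_u as a combination of the values of the Fourier transform at v + u and
v - u. *)
Lemma same_fourier_cos f g u : same_fourier f g ->
  same_fourier (fun w => f w * cos (X u w)) (fun w => g w * cos (Y u w)).
Proof.
move=> [bf bg h].
have bfc v := bounded_measurableM bf (bounded_measurable_cos (mX v)).
have bgc v := bounded_measurableM bg (bounded_measurable_cos (mY v)).
have bfs v := bounded_measurableM bf (bounded_measurable_sin (mX v)).
have bgs v := bounded_measurableM bg (bounded_measurable_sin (mY v)).
split=> // v; split.
- transitivity (\int[P]_w (2^-1 * (f w * cos (X (v + u) w)) +
                            2^-1 * (f w * cos (X (v - u) w)))).
    by apply: eq_Rintegral => w _; rewrite linXB linXD cosB cosD; field.
  rewrite expectationD; [|exact: bounded_measurableZ..].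
  rewrite !expectationZ// (h _).1 (h _).1 -!expectationZ//.
  rewrite -expectationD; [|exact: bounded_measurableZ..].
  by apply: eq_Rintegral => w _; rewrite linYB linYD cosB cosD; field.
- transitivity (\int[P]_w (2^-1 * (f w * sin (X (v + u) w)) +
                            2^-1 * (f w * sin (X (v - u) w)))).
    by apply: eq_Rintegral => w _; rewrite linXB linXD sinD sinB; field.
  rewrite expectationD; [|exact: bounded_measurableZ..].
  rewrite !expectationZ// (h _).2 (h _).2 -!expectationZ//.
  rewrite -expectationD; [|exact: bounded_measurableZ..].
  by apply: eq_Rintegral => w _; rewrite linYB linYD sinD sinB; field.
Qed.

Lemma same_fourier_sin f g u : same_fourier f g ->
  same_fourier (fun w => f w * sin (X u w)) (fun w => g w * sin (Y u w)).
Proof.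
move=> [bf bg h].
have bfc v := bounded_measurableM bf (bounded_measurable_cos (mX v)).
have bgc v := bounded_measurableM bg (bounded_measurable_cos (mY v)).
have bfs v := bounded_measurableM bf (bounded_measurable_sin (mX v)).
have bgs v := bounded_measurableM bg (bounded_measurable_sin (mY v)).
split=> // v; split.
- transitivity (\int[P]_w (2^-1 * (f w * sin (X (v + u) w)) +
                            (- 2^-1) * (f w * sin (X (v - u) w)))).
    by apply: eq_Rintegral => w _; rewrite linXB linXD sinD sinB; field.
  rewrite expectationD; [|exact: bounded_measurableZ..].
  rewrite !expectationZ// (h _).2 (h _).2 -!expectationZ//.
  rewrite -expectationD; [|exact: bounded_measurableZ..].
  by apply: eq_Rintegral => w _; rewrite linYB linYD sinD sinB; field.
- transitivity (\int[P]_w (2^-1 * (f w * cos (X (v - u) w)) +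
                            (- 2^-1) * (f w * cos (X (v + u) w)))).
    by apply: eq_Rintegral => w _; rewrite linXB linXD cosB cosD; field.
  rewrite expectationD; [|exact: bounded_measurableZ..].
  rewrite !expectationZ// (h _).1 (h _).1 -!expectationZ//.
  rewrite -expectationD; [|exact: bounded_measurableZ..].
  by apply: eq_Rintegral => w _; rewrite linYB linYD cosB cosD; field.
Qed.

(** Multipliers form an algebra closed under bounded limits, even though
[same_fourier] is not closed under products. *)
Definition multiplier f g := [/\ bounded_measurable f, bounded_measurable g &
  forall f' g', same_fourier f' g' ->
    same_fourier (fun w => f' w * f w) (fun w => g' w * g w)].

Lemma multiplier_ext f g f2 g2 : f =1 f2 -> g =1 g2 ->
  multiplier f g -> multiplier f2 g2.
Proof. by move=> /funext -> /funext ->. Qed.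

Lemma multiplier_cst (r : R) : multiplier (fun=> r) (fun=> r).
Proof.
split; [exact: bounded_measurable_cst|exact: bounded_measurable_cst|].
move=> f g h; have := same_fourier_lin r 0 h h.
by congr same_fourier; apply/funext => w; rewrite mul0r addr0 mulrC.
Qed.

Lemma multiplier_lin (a b : R) f1 f2 g1 g2 :
  multiplier f1 g1 -> multiplier f2 g2 ->
  multiplier (fun w => a * f1 w + b * f2 w) (fun w => a * g1 w + b * g2 w).
Proof.
move=> [bf1 bg1 h1] [bf2 bg2 h2]; split.
- by apply: bounded_measurableD; exact: bounded_measurableZ.
- by apply: bounded_measurableD; exact: bounded_measurableZ.
- move=> f g h; have := same_fourier_lin a b (h1 _ _ h) (h2 _ _ h).
  by congr same_fourier; apply/funext => w; rewrite mulrDr !(mulrCA _ a) !(mulrCA _ b).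
Qed.

Lemma multiplierM f1 f2 g1 g2 : multiplier f1 g1 -> multiplier f2 g2 ->
  multiplier (fun w => f1 w * f2 w) (fun w => g1 w * g2 w).
Proof.
move=> [bf1 bg1 h1] [bf2 bg2 h2]; split; try exact: bounded_measurableM.
move=> f g h; have := h2 _ _ (h1 _ _ h).
by congr same_fourier; apply/funext => w; rewrite mulrA.
Qed.

Lemma multiplierX f g n : multiplier f g ->
  multiplier (fun w => f w ^+ n) (fun w => g w ^+ n).
Proof.
move=> h; elim: n => [|n IH]; first exact: (multiplier_cst 1).
have := multiplierM h IH.
by apply: multiplier_ext => w; rewrite exprS.
Qed.

Lemma multiplier_onem f g : multiplier f g ->
  multiplier (fun w => 1 - f w) (fun w => 1 - g w).
Proof.
move=> h; have := multiplier_lin 1 (-1) (multiplier_cst 1) h.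
by apply: multiplier_ext => w; rewrite mul1r mulN1r.
Qed.

Lemma multiplier_cvg (f_ g_ : nat -> Omega -> R) f g (M : R) :
  (forall n, multiplier (f_ n) (g_ n)) ->
  (forall n w, `|f_ n w| <= M) -> (forall n w, `|g_ n w| <= M) ->
  (forall w, f_ n w @[n --> \oo] --> f w) ->
  (forall w, g_ n w @[n --> \oo] --> g w) ->
  multiplier f g.
Proof.
move=> H fM gM ff gg.
have mf n : measurable_fun setT (f_ n) by have [[]] := H n.
have mg n : measurable_fun setT (g_ n) by have [_ []] := H n.
have [bf _] := cvg_expectation P mf fM ff.
have [bg _] := cvg_expectation P mg gM gg.
split=> // f' g' h; have [[_ [M1 f'M]] [_ [M2 g'M]] _] := h.
have M1_0 (w : Omega) : 0 <= M1 by exact: le_trans (normr_ge0 _) (f'M w).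
have M2_0 (w : Omega) : 0 <= M2 by exact: le_trans (normr_ge0 _) (g'M w).
apply: (@same_fourier_cvg (fun n w => f' w * f_ n w) (fun n w => g' w * g_ n w)
  _ _ ((M1 + M2) * M)).
- by move=> n; have [_ _] := H n; exact.
- move=> n w; rewrite normrM ler_pM// (le_trans (f'M w))// lerDl.
  exact: M2_0 w.
- move=> n w; rewrite normrM ler_pM// (le_trans (g'M w))// lerDr.
  exact: M1_0 w.
- by move=> w; apply: cvgM; [exact: cvg_cst|exact: ff].
- by move=> w; apply: cvgM; [exact: cvg_cst|exact: gg].
Qed.

(** The polynomials [step_poly] of a multiplier are multipliers. *)
Lemma multiplier_gt0 f g : (forall w, `|f w| <= 1) -> (forall w, `|g w| <= 1) ->
  multiplier f g ->
  multiplier (fun w => (0 < f w)%R%:R) (fun w => (0 < g w)%R%:R).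
Proof.
move=> f1 g1 h.
apply: (@multiplier_cvg (fun n w => step_poly n (f w)) (fun n w => step_poly n (g w))
  _ _ 1).
- move=> n; apply: multiplierM.
    exact/multiplier_onem/multiplierX/multiplier_onem/multiplierX.
  apply/multiplierX/multiplier_onem/multiplierX.
  have := multiplier_lin 2^-1 0 (multiplier_onem h) (multiplier_cst 0).
  by apply: multiplier_ext => w; rewrite mulr0 addr0 mulrC.
- by move=> n w; exact: step_poly_bound.
- by move=> n w; exact: step_poly_bound.
- by move=> w; exact: cvg_step_poly.
- by move=> w; exact: cvg_step_poly.
Qed.

Lemma multiplier_ray v (a : R) :
  multiplier (fun w => (a < X v w)%R%:R) (fun w => (a < Y v w)%R%:R).
Proof.
have sinle (x : R) : `|sin x| <= 1 by rewrite ler_norml sin_geN1 sin_le1.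
have ble (b : bool) : `|b%:R| <= 1 :> R by case: b; rewrite ?normr1 ?normr0.
apply: (@multiplier_cvg (fun n w => (0 < sin (n.+1%:R^-1 * (X v w - a)))%R%:R)
  (fun n w => (0 < sin (n.+1%:R^-1 * (Y v w - a)))%R%:R) _ _ 1) => //;
  try by move=> w; exact: cvg_gt0_sin.
move=> n; apply: multiplier_gt0 => //.
set r := n.+1%:R^-1; have mc : multiplier (fun w => cos (X (r *: v) w))
    (fun w => cos (Y (r *: v) w)).
  split; [exact: bounded_measurable_cos|exact: bounded_measurable_cos|].
  by move=> f g; exact: same_fourier_cos.
have ms : multiplier (fun w => sin (X (r *: v) w)) (fun w => sin (Y (r *: v) w)).
  split; [exact: bounded_measurable_sin|exact: bounded_measurable_sin|].
  by move=> f g; exact: same_fourier_sin.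
(* sin (r (x - a)) is a linear combination of sin (r x) and cos (r x). *)
have := multiplier_lin (cos (r * a)) (- sin (r * a)) ms mc.
by apply: multiplier_ext => w; rewrite mulrBr sinB (linXZ, linYZ); ring.
Qed.

(** Products of indicators give intersections, 1 - f gives complements, and the
indicators of countable unions are bounded limits of those of finite unions. *)
Lemma sigma_algebra_multiplier d' (T : measurableType d') (F G : Omega -> T) :
  measurable_fun setT F -> measurable_fun setT G ->
  sigma_algebra setT
    [set E : set T | measurable E /\
      multiplier (fun w => \1_E (F w)) (fun w => \1_E (G w))].
Proof.
move=> mF mG.
have indic_le (E : set T) x : `|\1_E x| <= 1 :> R.
  by rewrite indicE; case: (_ \in _); rewrite ?normr1 ?normr0.
split.
- split; first exact: measurable0.
  by apply: multiplier_ext (multiplier_cst 0) => w; rewrite indic0.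
- move=> E [mE h]; rewrite setTD; split; first exact: measurableC.
  by apply: multiplier_ext (multiplier_onem h) => w; rewrite !indicE in_setC;
    case: (_ \in E); rewrite ?subrr ?subr0.
- move=> E_ hE; split; first by apply: bigcupT_measurable => n; have [] := hE n.
  pose U n := \big[setU/set0]_(i < n) E_ i.
  have hU n : multiplier (fun w => \1_(U n) (F w)) (fun w => \1_(U n) (G w)).
    elim: n => [|n IH].
      by apply: multiplier_ext (multiplier_cst 0) => w; rewrite /U big_ord0 indic0.
    have [_ hn] := hE n.
    have := multiplier_onem (multiplierM (multiplier_onem IH) (multiplier_onem hn)).
    by apply: multiplier_ext => w; rewrite /U big_ord_recr/= !indicE in_setU;
      case: (_ \in _); case: (_ \in _); rewrite ?(subrr, subr0, mul0r, mulr0, mulr1).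
  have cvgU x : \1_(U n) x @[n --> \oo] --> (\1_(\bigcup_n E_ n) x : R).
    apply: cvg_near_cst; have [[k _ Ek]|nE] := pselect ((\bigcup_n E_ n) x).
      exists k.+1 => // n /= kn; rewrite !indicE !mem_set//; first by exists k.
      by rewrite /U -bigcup_mkord; exists k.
    apply: nearW => n; rewrite !indicE !memNset// /U -bigcup_mkord.
    by move=> [k _ Ek]; apply: nE; exists k.
  by apply: (@multiplier_cvg (fun n w => \1_(U n) (F w)) (fun n w => \1_(U n) (G w))
    _ _ 1).
Qed.

Lemma multiplier_borel v (B : set R) : measurable B ->
  multiplier (fun w => \1_B (X v w)) (fun w => \1_B (Y v w)).
Proof.
move=> mB; have sa := sigma_algebra_multiplier (mX v) (mY v).
have : <<s @RGenOInfty.G R >> B by rewrite -[X in X B]RGenOInfty.measurableE.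
move=> /(_ _ (conj sa _))[]//.
move=> _ [a ->]; split; first exact: measurable_itv.
by apply: multiplier_ext (multiplier_ray v a) => w; rewrite indicE;
  congr (nat_of_bool _)%:R; apply/idP/idP; rewrite inE/= in_itv/= andbT.
Qed.

End FourierTransfer.

(** * Distributions as random variables *)

Section Distributions.
Context (R : realType) (D : set (Cplx R)).
Implicit Types (S T : distr D) (phi psi : testfun D).

Lemma distr_lin_test T (a : R) phi psi : T (a *: phi + psi) = a * T phi + T psi.
Proof. by have := distrP T; rewrite inE => -[+ _]; exact. Qed.

Lemma distrDE S T phi : (S + T) phi = S phi + T phi.
Proof. by []. Qed.

Lemma distrZE (a : R) T phi : (a *: T) phi = a * T phi.
Proof. by []. Qed.

Lemma distr_sumE (I : Type) (r : seq I) (F : I -> distr D) phi :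
  (\sum_(i <- r) F i) phi = \sum_(i <- r) F i phi.
Proof.
elim: r => [|i r IH]; first by rewrite !big_nil.
by rewrite !big_cons distrDE IH.
Qed.

Lemma distr_ext S T : (forall phi, S phi = T phi) -> S = T.
Proof. by move=> ST; apply/val_inj/funext. Qed.

Lemma distr0_test T : T 0 = 0.
Proof.
have := distr_lin_test T (-1) 0 0.
by rewrite scaler0 addr0 mulN1r addNr.
Qed.

Lemma distrN_test T phi : T (- phi) = - T phi.
Proof.
have := distr_lin_test T (-1) phi 0.
by rewrite scaleN1r addr0 distr0_test addr0 mulN1r.
Qed.

Lemma distr_sum_test T (I : Type) (r : seq I) (a : I -> R) (phi : I -> testfun D) :
  T (\sum_(i <- r) a i *: phi i) = \sum_(i <- r) a i * T (phi i).
Proof.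
elim: r => [|i r IH]; first by rewrite !big_nil distr0_test.
by rewrite !big_cons distr_lin_test IH.
Qed.

Lemma measurable_distr_eval phi : measurable_fun setT (fun T : distr D => T phi).
Proof.
by move=> _ B mB; rewrite setTI; apply: sub_sigma_algebra; exists phi, B.
Qed.

Lemma measurable_RV_eval d (Omega : measurableType d) (P : probability Omega R)
    (h : {RV P >-> distr D}) phi : measurable_fun setT (fun w => h w phi).
Proof. exact: (measurableT_comp (measurable_distr_eval phi)). Qed.

Lemma measurable_fun_distr d (Omega : measurableType d) (F : Omega -> distr D) :
  (forall phi, measurable_fun setT (fun w => F w phi)) -> measurable_fun setT F.
Proof.
move=> mF; apply: (@measurability _ _ _ _ _ _ (@cylinders R D)) => //.
move=> _ [_ [phi [B [mB ->]] <-]].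
by have := mF phi measurableT B mB.
Qed.

End Distributions.

(** * Laws of one field *)

Section OneDimensionalLaws.
Context (R : realType) d (Omega : measurableType d) (P : probability Omega R).
Implicit Types (h : {RV P >-> distr (@disk R)}) (phi : testfun (@disk R)).
Local Notation sd phi := (Num.sqrt (green_energy phi)).

(** The case s = 0 is the Dirac mass. *)
Lemma integral_centered_gaussian (s : R) (f : R -> R) :
  measurable_fun setT f -> (forall x, 0 <= f x) ->
  forall (Y : Omega -> R), measurable_fun setT Y ->
  (forall B, measurable B -> P [set w | B (Y w)] = centered_gaussian s B) ->
  (\int[P]_w (f (Y w))%:E = if s == 0%R then (f 0%R)%:E
     else \int[lebesgue_measure]_x (f x * normal_pdf 0 s x)%:E)%E.
Proof.
move=> mf f0 Y mY law.
have PE B : measurable B -> (\int[P]_w (\1_B (Y w) * 1)%:E)%E = P [set w | B (Y w)].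
  move=> mB; rewrite -expectation_indic// /Rintegral fineK.
    by apply: eq_integral => w _; rewrite mulr1.
  apply: integrable_fin_num => //.
  by apply: bounded_measurable_integrable; exact: bounded_measurable_indic_comp.
under eq_integral do rewrite -(mulr1 (f _)).
case: ifPn => [/eqP s0|s0].
  rewrite (@eq_integral_weighted _ _ _ _ _ _
    _ P Y (fun=> 1) (\d_(0 : R)) id (fun=> 1) f) //.
  - rewrite integral_dirac//= ?diracT ?mul1e ?mulr1//.
    by apply/measurable_EFinP/measurable_funM.
  - move=> E mE; rewrite PE// law// /centered_gaussian s0 eqxx.
    rewrite integral_dirac//= ?diracT ?mul1e ?mulr1 ?diracE//.
    by apply/measurable_EFinP/measurable_funM => //; exact: measurable_indic.
rewrite (@eq_integral_weighted _ _ _ _ _ _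
    _ P Y (fun=> 1) lebesgue_measure id (normal_pdf 0 s) f) //.
- exact: measurable_normal_pdf.
- by move=> x; exact: normal_pdf_ge0.
- move=> E mE; rewrite PE// law// /centered_gaussian (negbTE s0) /normal_prob.
  rewrite [LHS]integral_mkcond.
  transitivity (\int[lebesgue_measure]_x (\1_E x * normal_pdf 0 s x)%:E)%E => //.
  apply: eq_integral => x _.
  by rewrite patchE indicE; case: ifP => _; rewrite ?mul1r ?mul0r.
Qed.

Lemma GFF_cos h phi : zero_boundary_GFF h ->
  \int[P]_w cos (h w phi) = expR (- (sd phi ^+ 2 / 2)).
Proof.
move=> gff; set s := sd phi.
have mh := measurable_RV_eval h phi.
have H := @integral_centered_gaussian s (fun x => cos x + 1) _ _ _ mh (gff phi).
have bc := bounded_measurable_cos mh.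
have b1 := @bounded_measurable_cst _ Omega R 1.
apply: (@addIr _ (\int[P]_w (1 : R))); rewrite -expectationD// expectation_cst.
rewrite /Rintegral H.
- case: eqP => [->|/eqP s0] /=; first by rewrite cos0 expr0n mul0r oppr0 expR0.
  rewrite -/(Rintegral _ _ _) -integral_cos_normal_pdf//.
  under eq_Rintegral do rewrite mulrDl mul1r.
  rewrite RintegralD//.
  + by rewrite [X in _ + X]/Rintegral integral_normal_pdf.
  + apply: (@integrable_mul_normal_pdf _ _ _ 1) => //; first exact: measurable_cos.
    move=> x; rewrite mul1r (@le_trans _ _ 1) ?lerDl ?sqr_ge0//.
    by rewrite ler_norml cos_geN1 cos_le1.
  + exact: integrable_normal_pdf.
- by apply: measurable_funD => //; exact: measurable_cos.
- by move=> x; rewrite -lerBlDr sub0r cos_geN1.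
Qed.

Lemma GFF_sqr h phi : zero_boundary_GFF h ->
  (\int[P]_w (h w phi ^+ 2)%:E = (sd phi ^+ 2)%:E)%E.
Proof.
move=> gff; have mh := measurable_RV_eval h phi.
rewrite (@integral_centered_gaussian (sd phi) (fun x => x ^+ 2) _ _ _ mh (gff phi)).
- case: eqP => [->|/eqP s0]; first by rewrite expr0n.
  exact: integral_sqr_normal_pdf.
- exact: exprn_measurable.
- by move=> x; exact: sqr_ge0.
Qed.

(** The Green energy is even, so h(phi) and h(-phi) = - h(phi) have the same law. *)
Lemma GFF_sin h phi : zero_boundary_GFF h -> \int[P]_w sin (h w phi) = 0.
Proof.
move=> gff; have mh psi := measurable_RV_eval h psi.
have eN : green_energy (- phi) = green_energy phi.
  have E x : (- phi) x = - phi x by [].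
  rewrite /green_energy /area_int; congr fine.
  apply: eq_integral => p _; congr (_%:E); apply: eq_Rintegral => q _.
  by rewrite !E mulrN !mulNr opprK.
have msin1 : measurable_fun setT (fun x : R => sin x + 1).
  by apply: measurable_funD => //; exact: measurable_sin.
have sin1_ge0 (x : R) : 0 <= sin x + 1 by rewrite -lerBlDr sub0r sin_geN1.
have gffN B : measurable B ->
    P [set w | B (h w (- phi))] = centered_gaussian (sd phi) B.
  by rewrite -eN; exact: gff.
have H := integral_centered_gaussian msin1 sin1_ge0.
have E : \int[P]_w (sin (h w phi) + 1) = \int[P]_w (sin (h w (- phi)) + 1).
  by rewrite /Rintegral (H _ _ (mh phi) (gff phi)) (H _ _ (mh (- phi)) gffN).
have bs psi := bounded_measurable_sin (mh psi).
have b1 := @bounded_measurable_cst _ Omega R 1.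
move: E; rewrite !expectationD// => /addIr.
under [X in _ = X]eq_Rintegral do rewrite distrN_test sinN -mulN1r.
rewrite expectationZ// mulN1r => /eqP.
by rewrite -subr_eq0 opprK -mulr2n mulrn_eq0 => /eqP.
Qed.

End OneDimensionalLaws.

(** * Independence *)

(** The hypothesis says that the expectation of [W] factors out of events of [Y].
Adding constants makes [W] and [f] nonnegative, and then both sides are weighted
integrals that agree on indicators. *)
Lemma expectation_factorization d (Omega : measurableType d) (R : realType)
    (P : probability Omega R) d' (T : measurableType d') (Y : Omega -> T)
    (W : Omega -> R) (c : R) (f : T -> R) :
  measurable_fun setT Y -> bounded_measurable W ->
  (forall B, measurable B ->
    \int[P]_w (W w * \1_B (Y w)) = c * \int[P]_w \1_B (Y w)) ->
  bounded_measurable f ->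
  \int[P]_w (W w * f (Y w)) = c * \int[P]_w f (Y w).
Proof.
move=> mY bW H [mf [M fM]].
have bfY : bounded_measurable (fun w => f (Y w)).
  by split; [exact: measurableT_comp|exists M => w].
have b1 (r : R) : bounded_measurable (fun _ : Omega => r) by exact: bounded_measurable_cst.
have EW : \int[P]_w W w = c.
  have := H _ measurableT; rewrite (_ : (fun w => \1_setT (Y w)) = (fun=> 1)).
    rewrite expectation_cst mulr1 => <-.
    by apply: eq_Rintegral => w _; rewrite indicT mulr1.
  by apply/funext => w; rewrite indicT.
have [mW [K0 WK]] := bW; pose K := `|K0| + `|c|.
have addN_ge0 (x y : R) : `|x| <= y -> 0 <= x + y.
  by rewrite ler_norml => /andP[+ _]; rewrite -subr_ge0 opprK.
have WK0 w : 0 <= W w + K.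
  by apply: addN_ge0; rewrite (le_trans (WK w))// (le_trans (ler_norm _))// lerDl.
have cK0 : 0 <= c + K by apply: addN_ge0; rewrite lerDr.
have fM0 y : 0 <= f y + M by exact: addN_ge0.
have bWK : bounded_measurable (fun w => W w + K) by exact: bounded_measurableD.
have bfM : bounded_measurable (fun w => f (Y w) + M) by exact: bounded_measurableD.
have G : \int[P]_w ((f (Y w) + M) * (W w + K)) = \int[P]_w ((f (Y w) + M) * (c + K)).
  congr fine; apply: (@eq_integral_weighted _ _ _ _ _ _ _ P Y (fun w => W w + K)
    P Y (fun=> c + K) (fun y => f y + M)) => //.
  - by have [] := bWK.
  - move=> B mB; have bB := bounded_measurable_indic_comp R mY mB.
    have bWB := bounded_measurableM bW bB.
    rewrite -[LHS]fineK; last first.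
      by apply/integrable_fin_num/bounded_measurable_integrable/bounded_measurableM.
    rewrite -[RHS]fineK; last first.
      by apply/integrable_fin_num/bounded_measurable_integrable/bounded_measurableM.
    congr EFin; rewrite -!/(Rintegral _ _ _).
    transitivity (\int[P]_w (W w * \1_B (Y w) + K * \1_B (Y w))).
      by apply: eq_Rintegral => w _; rewrite mulrC mulrDl.
    rewrite expectationD//; last exact: bounded_measurableZ.
    rewrite H// expectationZ// -mulrDl -expectationZ//.
    by apply: eq_Rintegral => w _; rewrite mulrC.
  - exact: measurable_funD.
have bWf := bounded_measurableM bW bfY.
have E1 : \int[P]_w ((f (Y w) + M) * (W w + K)) =
    \int[P]_w (W w * f (Y w)) + (M * c + K * (\int[P]_w f (Y w) + M)).
  transitivity (\int[P]_w (W w * f (Y w) + (M * W w + K * (f (Y w) + M)))).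
    by apply: eq_Rintegral => w _; ring.
  rewrite expectationD//; last by apply: bounded_measurableD; exact: bounded_measurableZ.
  rewrite expectationD; [|exact: bounded_measurableZ..].
  by rewrite !expectationZ// EW expectationD// expectation_cst.
have E2 : \int[P]_w ((f (Y w) + M) * (c + K)) = (c + K) * (\int[P]_w f (Y w) + M).
  rewrite -[in RHS](expectation_cst P M) -expectationD// -expectationZ//.
  by apply: eq_Rintegral => w _; rewrite mulrC.
by move: G; rewrite E1 E2; set a := Rintegral _ _ _; set b := Rintegral _ _ _; lra.
Qed.

Lemma expectation_prod_indic d (Omega : measurableType d) (R : realType)
    (P : probability Omega R) d' (T : measurableType d') (n : nat)
    (h : 'I_n -> {RV P >-> T}) (E : 'I_n -> set T) :
  (forall i, measurable (E i)) ->
  (\int[P]_w (\prod_j \1_(E j) (h j w)))%:E = P [set w | forall i, E i (h i w)].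
Proof.
move=> mE.
have mEh i : measurable [set w | E i (h i w)].
  by rewrite -[X in measurable X]setTI; exact: measurable_funP.
have mall : measurable [set w | forall i, E i (h i w)].
  rewrite (_ : [set w | _] = \bigcap_(i in [set` 'I_n]) [set w | E i (h i w)]).
    by apply: fin_bigcap_measurable => // i _.
  by apply/seteqP; split => [w Hw i _|w Hw i]; [exact: Hw|exact: (Hw i)].
rewrite -[RHS](expectation_indic P (@measurable_id _ Omega setT) mall).
congr EFin; apply: eq_Rintegral => w _; rewrite /= indicE.
have [Hw|nHw] := pselect (forall i, E i (h i w)).
  by rewrite (mem_set Hw) big1// => i _; rewrite indicE mem_set.
rewrite (memNset nHw); move: nHw => /existsNP[i nEi].
by rewrite (bigD1 i)//= indicE memNset// mul0r.
Qed.

Section Independence.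
Context d (Omega : measurableType d) (R : realType) (P : probability Omega R).
Context d' (T : measurableType d') (n : nat) (h : 'I_n -> {RV P >-> T}).
Hypothesis indep : mutually_independent h.

(** A random variable built from the [h j] with j in s, seen from the others.  Keeping
the product over all the remaining indices makes induction on s possible. *)
Definition independent_outside (s : seq 'I_n) (Z : Omega -> R) :=
  bounded_measurable Z /\ forall E : 'I_n -> set T, (forall i, measurable (E i)) ->
  \int[P]_w (Z w * \prod_(j | j \notin s) \1_(E j) (h j w)) =
  \int[P]_w Z w * \prod_(j | j \notin s) \int[P]_w \1_(E j) (h j w).

Let bprod (Q : pred 'I_n) (E : 'I_n -> set T) : (forall i, measurable (E i)) ->
  bounded_measurable (fun w => \prod_(j | Q j) \1_(E j) (h j w) : R).
Proof.
move=> mE; elim: (index_enum _) => [|j r IH].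
  by under eq_fun do rewrite big_nil; exact: bounded_measurable_cst.
under eq_fun do rewrite big_cons; case: (Q j) => //.
by apply: bounded_measurableM => //; exact: bounded_measurable_indic_comp.
Qed.

Lemma independent_outside_nil : independent_outside [::] (fun=> 1).
Proof.
split; first exact: bounded_measurable_cst.
move=> E mE; rewrite expectation_cst mul1r.
transitivity (\int[P]_w (\prod_j \1_(E j) (h j w)) : R).
  by apply: eq_Rintegral => w _; rewrite mul1r.
apply: EFin_inj; rewrite expectation_prod_indic// indep// -prodEFin.
by apply: eq_big => // i _; rewrite expectation_indic.
Qed.

Lemma independent_outside_lin s (a b : R) Z1 Z2 :
  independent_outside s Z1 -> independent_outside s Z2 ->
  independent_outside s (fun w => a * Z1 w + b * Z2 w).
Proof.
move=> [b1 h1] [b2 h2].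
have [bZ1 bZ2] := (bounded_measurableZ a b1, bounded_measurableZ b b2).
split; first exact: bounded_measurableD.
move=> E mE; have bp := bprod (fun j => j \notin s) mE.
rewrite expectationD// !expectationZ// mulrDl -!mulrA -h1// -h2//.
have [bp1 bp2] := (bounded_measurableM b1 bp, bounded_measurableM b2 bp).
rewrite -!expectationZ// -expectationD; [|exact: bounded_measurableZ..].
by apply: eq_Rintegral => w _; rewrite mulrDl !mulrA.
Qed.

(** The hypothesis on [Z], for families of events whose k-th member is arbitrary, says
that an expectation factors out of events of h_k; hence it also factors out of
[f] applied to h_k. *)
Lemma independent_outside_cons s (k : 'I_n) Z (f : T -> R) :
  k \notin s -> bounded_measurable f -> independent_outside s Z ->
  independent_outside (k :: s) (fun w => Z w * f (h k w)) /\
  \int[P]_w (Z w * f (h k w)) = \int[P]_w Z w * \int[P]_w f (h k w).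
Proof.
move=> ks bf [bZ hZ].
have bfk : bounded_measurable (fun w => f (h k w)).
  by have [mf [M fM]] := bf; split; [exact: measurableT_comp|exists M => w].
have pE (F : 'I_n -> R) :
    \prod_(j | j \notin s) F j = F k * \prod_(j | j \notin k :: s) F j.
  rewrite (bigD1 k)//=; congr (_ * _); apply: eq_bigl => j.
  by rewrite inE negb_or andbC.
have G E : (forall i, measurable (E i)) ->
    \int[P]_w (Z w * f (h k w) * \prod_(j | j \notin k :: s) \1_(E j) (h j w)) =
    \int[P]_w Z w * (\prod_(j | j \notin k :: s) \int[P]_w \1_(E j) (h j w)) *
    \int[P]_w f (h k w).
  move=> mE; have bp := bprod (fun j => j \notin k :: s) mE.
  rewrite -(@expectation_factorization _ _ _ _ _ _ _
    (fun w => Z w * \prod_(j | j \notin k :: s) \1_(E j) (h j w)))//.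
  - by apply: eq_Rintegral => w _; rewrite mulrAC.
  - exact: bounded_measurableM.
  - move=> B mB; pose E' j := if j == k then B else E j.
    have mE' j : measurable (E' j) by rewrite /E'; case: ifP.
    have E'E j : j \notin k :: s -> E' j = E j.
      by rewrite inE negb_or /E' => /andP[/negbTE ->].
    have E'k : E' k = B by rewrite /E' eqxx.
    have pE' (F : set T -> 'I_n -> R) : \prod_(j | j \notin k :: s) F (E' j) j =
        \prod_(j | j \notin k :: s) F (E j) j.
      by apply: eq_bigr => j jks; rewrite E'E.
    rewrite -[RHS]mulrA [X in _ = _ * X]mulrC.
    rewrite -(pE' (fun B j => \int[P]_w \1_B (h j w))).
    have := pE (fun j => \int[P]_w \1_(E' j) (h j w)); rewrite E'k => <-.
    rewrite -hZ//; apply: eq_Rintegral => w _.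
    by rewrite pE E'k (pE' (fun B j => \1_B (h j w))) -mulrA [X in _ * X]mulrC.
have GT : \int[P]_w (Z w * f (h k w)) = \int[P]_w Z w * \int[P]_w f (h k w).
  have := G (fun=> setT) (fun=> measurableT).
  rewrite [X in _ = _ * X * _]big1 ?mulr1; last first.
    move=> j _; rewrite -[RHS](expectation_cst P 1).
    by apply: eq_Rintegral => w _; rewrite indicT.
  move=> <-; apply: eq_Rintegral => w _; rewrite big1 ?mulr1// => j _.
  by rewrite indicT.
split=> //; split; first exact: bounded_measurableM.
by move=> E mE; rewrite G// GT mulrAC.
Qed.

End Independence.

(** * Sums of squares and orthogonal matrices *)

(** The row vector x A has the same norm as x. *)
Lemma sum_sqr_orthogonal (R : comNzRingType) (n : nat) (A : 'M[R]_n) (x : 'I_n -> R) :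
  A *m A^T = 1%:M ->
  \sum_j (\sum_i A i j * x i) ^+ 2 = \sum_i x i ^+ 2.
Proof.
move=> A_orth; pose u : 'rV[R]_n := \row_i x i.
have sqE (v : 'rV[R]_n) : \sum_j v 0 j ^+ 2 = (v *m v^T) 0 0.
  by rewrite mxE; apply: eq_bigr => j _; rewrite mxE expr2.
transitivity (\sum_j (u *m A) 0 j ^+ 2).
  apply: eq_bigr => j _; rewrite mxE; congr (_ ^+ 2).
  by apply: eq_bigr => i _; rewrite mxE mulrC.
rewrite sqE trmx_mul mulmxA -(mulmxA u) A_orth mulmx1 -sqE.
by apply: eq_bigr => i _; rewrite mxE.
Qed.

Lemma left_inverse_sum (R : comNzRingType) (n : nat) (A B : 'M[R]_n)
    (x : 'I_n -> R) i : B *m A = 1%:M ->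
  \sum_j B i j * (\sum_k A j k * x k) = x i.
Proof.
move=> BA; pose v : 'cV[R]_n := \col_k x k.
have := congr1 (fun N : 'cV[R]_n => N i 0) (mulmxA B A v).
rewrite BA mul1mx !mxE => <-; apply: eq_bigr => j _; rewrite mxE.
by congr (_ * _); apply: eq_bigr => k _; rewrite mxE.
Qed.

(** * Rotation of independent Gaussian fields *)

(** Of the fields only the following is used: they are independent and, against each
test function, they all have the same characteristic function exp(- var / 2) and
second moment var. *)
Section IndependentFields.
Context (R : realType) d (Omega : measurableType d) (P : probability Omega R).
Context (D : set (Cplx R)).
Context (n : nat) (h : 'I_n -> {RV P >-> distr D}).
Context (var : testfun D -> R).
Hypothesis hcos : forall i phi,
  \int[P]_w cos (h i w phi) = expR (- (var phi / 2)).
Hypothesis hsin : forall i phi, \int[P]_w sin (h i w phi) = 0.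
Hypothesis hsqr : forall i phi, (\int[P]_w (h i w phi ^+ 2)%:E = (var phi)%:E)%E.
Hypothesis indep : mutually_independent h.

(** Induction over the indices with the addition formulas.  The partial sums are kept
independent of the fields that are still to be added. *)
Lemma gaussian_family_cos_sin (xi : 'I_n -> testfun D) :
  \int[P]_w cos (\sum_j h j w (xi j)) = expR (- ((\sum_j var (xi j)) / 2)) /\
  \int[P]_w sin (\sum_j h j w (xi j)) = 0.
Proof.
suff H : forall s : seq 'I_n, uniq s ->
    [/\ independent_outside h s (fun w => cos (\sum_(j <- s) h j w (xi j))),
        independent_outside h s (fun w => sin (\sum_(j <- s) h j w (xi j))),
        \int[P]_w cos (\sum_(j <- s) h j w (xi j)) =
          expR (- ((\sum_(j <- s) var (xi j)) / 2)) &
        \int[P]_w sin (\sum_(j <- s) h j w (xi j)) = 0].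
  by have [] := H _ (index_enum_uniq _).
elim=> [_|k s IH /= /andP[ks /IH[iC iS EC ES]]].
  have E (g : R -> R) : (fun w : Omega => g (\sum_(j <- [::]) h j w (xi j))) =
      (fun=> g 0) by apply/funext => w; rewrite big_nil.
  rewrite !E big_nil cos0 sin0 mul0r oppr0 expR0 !expectation_cst.
  have i1 := independent_outside_nil indep.
  split=> //; have := independent_outside_lin 0 0 i1 i1.
  by congr independent_outside; apply/funext => w; rewrite mul0r addr0.
have me := measurable_distr_eval (xi k).
have bcos : bounded_measurable (fun S : distr D => cos (S (xi k))).
  exact: bounded_measurable_cos.
have bsin : bounded_measurable (fun S : distr D => sin (S (xi k))).
  exact: bounded_measurable_sin.
have [icc Ecc] := independent_outside_cons ks bcos iC.
have [ics Ecs] := independent_outside_cons ks bsin iC.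
have [isc Esc] := independent_outside_cons ks bcos iS.
have [iss Ess] := independent_outside_cons ks bsin iS.
have ckE : (fun w => cos (\sum_(j <- k :: s) h j w (xi j))) = (fun w =>
    1 * (cos (\sum_(j <- s) h j w (xi j)) * cos (h k w (xi k))) +
    (-1) * (sin (\sum_(j <- s) h j w (xi j)) * sin (h k w (xi k)))).
  by apply/funext => w; rewrite big_cons addrC cosD mul1r mulN1r.
have skE : (fun w => sin (\sum_(j <- k :: s) h j w (xi j))) = (fun w =>
    1 * (sin (\sum_(j <- s) h j w (xi j)) * cos (h k w (xi k))) +
    1 * (cos (\sum_(j <- s) h j w (xi j)) * sin (h k w (xi k)))).
  by apply/funext => w; rewrite big_cons addrC sinD !mul1r.
have b2 f : independent_outside h (k :: s) f -> bounded_measurable f by case.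
rewrite ckE skE; split; [exact: independent_outside_lin..| |].
- rewrite expectationD; [|by apply/bounded_measurableZ/b2..].
  rewrite !expectationZ; [|exact: b2..].
  rewrite Ecc Ess ES mul0r mulr0 addr0 mul1r EC hcos -expRD big_cons.
  by congr expR; field.
- rewrite expectationD; [|by apply/bounded_measurableZ/b2..].
  rewrite !expectationZ; [|exact: b2..].
  by rewrite Esc Ecs ES mul0r mulr0 add0r mul1r hsin mulr0.
Qed.

Context (k : 'I_n) (A : 'M[R]_n).
Hypothesis A_orth : A *m A^T = 1%:M.

(** The variance is a quadratic form because it is a second moment: for a single field
h_k the sums of squares agree at each point of the probability space. *)
Lemma var_rotate (xi : 'I_n -> testfun D) :
  \sum_j var (\sum_i A i j *: xi i) = \sum_i var (xi i).
Proof.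
have sumE (eta : 'I_n -> testfun D) : ((\sum_j var (eta j))%:E =
    \int[P]_w (\sum_j h k w (eta j) ^+ 2)%:E)%E.
  have mh phi : measurable_fun setT (fun w => (h k w phi ^+ 2)%:E).
    by apply/measurable_EFinP/measurable_funX; exact: measurable_RV_eval.
  transitivity (\sum_j \int[P]_w (h k w (eta j) ^+ 2)%:E)%E.
    by rewrite -sumEFin; apply: eq_bigr => j _; rewrite hsqr.
  rewrite -ge0_integral_sum//; last by move=> i w _; rewrite lee_fin sqr_ge0.
  by apply: eq_integral => w _; rewrite sumEFin.
suff : (\sum_j var (\sum_i A i j *: xi i))%:E = (\sum_i var (xi i))%:E by case.
rewrite !sumE; apply: eq_integral => w _; congr EFin.
under eq_bigr => j _ do rewrite distr_sum_test.
exact: sum_sqr_orthogonal.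
Qed.

Context (hh : 'I_n -> {RV P >-> distr D}).
Hypothesis hhE : forall i w, hh i w = \sum_j A i j *: h j w.

(** The rotated fields tested against xi give the original ones tested against A^T xi,
so the two families of linear functionals have equal characteristic functions;
cylinder events, and then all events, are multipliers. *)
Lemma rotated_fields_joint_law (E : 'I_n -> set (distr D)) :
  (forall i, measurable (E i)) ->
  P [set w | forall i, E i (hh i w)] = P [set w | forall i, E i (h i w)].
Proof.
move=> mE.
pose V : lmodType R := {ffun 'I_n -> testfun D}.
pose X (v : V) w := \sum_j h j w (v j).
pose Y (v : V) w := \sum_j hh j w (v j).
have mX v : measurable_fun setT (X v).
  by apply: measurable_sum => j; exact: measurable_RV_eval.
have mY v : measurable_fun setT (Y v).
  by apply: measurable_sum => j; exact: measurable_RV_eval.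
have lin (g : 'I_n -> {RV P >-> distr D}) a (u v : V) w :
    \sum_j g j w ((a *: u + v) j) = a * (\sum_j g j w (u j)) + \sum_j g j w (v j).
  rewrite mulr_sumr -big_split/=; apply: eq_bigr => j _.
  by rewrite !ffunE distr_lin_test.
have YE v w : Y v w = \sum_j h j w (\sum_i A i j *: v i).
  rewrite /Y; under eq_bigr => i _ do rewrite hhE distr_sumE.
  by rewrite exchange_big/=; apply: eq_bigr => j _; rewrite distr_sum_test.
have ecos v : \int[P]_w cos (X v w) = \int[P]_w cos (Y v w).
  rewrite (gaussian_family_cos_sin v).1; under eq_Rintegral do rewrite YE.
  by rewrite (gaussian_family_cos_sin _).1 var_rotate.
have esin v : \int[P]_w sin (X v w) = \int[P]_w sin (Y v w).
  rewrite (gaussian_family_cos_sin v).2; under eq_Rintegral do rewrite YE.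
  by rewrite (gaussian_family_cos_sin _).2.
have linX a u v w : X (a *: u + v) w = a * X u w + X v w by exact: lin.
have linY a u v w : Y (a *: u + v) w = a * Y u w + Y v w by exact: lin.
pose mult := multiplier P X Y.
have mult_cyl i phi B : measurable B ->
    mult (fun w => \1_B (h i w phi)) (fun w => \1_B (hh i w phi)).
  move=> mB; pose v : V := [ffun j => if j == i then phi else 0].
  have vE (g : 'I_n -> {RV P >-> distr D}) w :
      \sum_j g j w (v j) = g i w phi.
    rewrite (bigD1 i)//= ffunE eqxx big1 ?addr0// => j /negbTE ji.
    by rewrite ffunE ji distr0_test.
  have := multiplier_borel P mX mY linX linY v mB.
  by apply: multiplier_ext => w; rewrite /X /Y vE.
have mult1 i (F : set (distr D)) : measurable F ->
    mult (fun w => \1_F (h i w)) (fun w => \1_F (hh i w)).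
  move=> mF; pose C := [set F : set (distr D) | measurable F /\
    mult (fun w => \1_F (h i w)) (fun w => \1_F (hh i w))].
  have sa : sigma_algebra setT C by exact: sigma_algebra_multiplier.
  suff cylC : @cylinders R D `<=` C by have [_] := mF C (conj sa cylC).
  move=> _ [phi [B [mB ->]]]; split; last exact: mult_cyl.
  by apply: sub_sigma_algebra; exists phi, B.
have multall : mult (fun w => \prod_j \1_(E j) (h j w)) (fun w => \prod_j \1_(E j) (hh j w)).
  elim: (index_enum _) => [|i r IH].
    by apply: multiplier_ext (multiplier_cst P mX mY 1) => w; rewrite big_nil.
  have := multiplierM (mult1 i _ (mE i)) IH.
  by apply: multiplier_ext => w; rewrite big_cons.
(* At the zero functional the cosine is 1. *)
have [_ _ /(_ _ _ (same_fourier1 ecos esin))[_ _ /(_ 0)[H _]]] := multall.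
have dropE (g : 'I_n -> {RV P >-> distr D}) :
    \int[P]_w (1 * (\prod_j \1_(E j) (g j w)) * cos (\sum_j g j w ((0 : V) j))) =
    \int[P]_w (\prod_j \1_(E j) (g j w)).
  apply: eq_Rintegral => w _; rewrite mul1r [X in cos X]big1 ?cos0 ?mulr1//.
  by move=> j _; rewrite ffunE distr0_test.
by rewrite -!expectation_prod_indic// -dropE -H dropE.
Qed.

End IndependentFields.

(** * Rotation of IG surfaces *)

Section RotationOfSurfaces.
Context {R : realType} {n : nat}.
Implicit Types (A B : 'M[R]_n) (c : 'I_n -> R) (X Y : @embedding R n).

Lemma rotate_fieldsE A (D : set (Cplx R)) (Psi : n.-tuple (distr D)) i phi :
  tnth (rotate_fields A Psi) i phi = \sum_j A i j * tnth Psi j phi.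
Proof.
rewrite tnth_mktuple distr_sumE.
by apply: eq_bigr => j _; rewrite distrZE.
Qed.

Lemma rotate_fieldsK A B (D : set (Cplx R)) : B *m A = 1%:M ->
  cancel (@rotate_fields R n A D) (@rotate_fields R n B D).
Proof.
move=> BA Psi; apply: eq_from_tnth => i; apply: distr_ext => phi.
rewrite rotate_fieldsE; under eq_bigr => j _ do rewrite rotate_fieldsE.
exact: left_inverse_sum.
Qed.

Definition rotate_embedding A X : embedding n :=
  Embedding (@dom_open _ _ X) (@dom_bounded _ _ X) (@marked_closure _ _ X)
    (rotate_fields A (fields X)).

Lemma rotate_embeddingK A B : B *m A = 1%:M ->
  cancel (rotate_embedding A) (rotate_embedding B).
Proof.
by move=> BA [D oD bD x Dx Psi]; rewrite /rotate_embedding/= rotate_fieldsK.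
Qed.

(** The relation between the fields and their pullbacks is linear, and its
inhomogeneous term is proportional to chi with a factor common to all fields. *)
Lemma ig_equiv_rotate A c c' X Y :
  (forall i, chi (c' i) = \sum_j A i j * chi (c j)) ->
  ig_equiv c X Y -> ig_equiv c' (rotate_embedding A X) (rotate_embedding A Y).
Proof.
move=> chiE [m [f [theta [hf fD cf fm [argf pb]]]]].
exists m, f, theta; split=> //; split=> // i.
pose S j := sval (cid2 (pb j)).
have SP j : is_pullback f (tnth (fields Y) j) (S j) by rewrite /S; case: cid2.
have SE j (phi : testfun (dom X)) : tnth (fields X) j phi = S j phi + chi (c j) *
    area_int (dom X) (fun z => (2 * pi * m%:~R - theta z) * phi z).
  by rewrite /S; case: cid2.
exists (\sum_j A i j *: S j).
  move=> phi psi phipsi; rewrite distr_sumE [RHS]rotate_fieldsE.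
  by apply: eq_bigr => j _; rewrite distrZE; congr (_ * _); exact: SP.
move=> phi; rewrite [LHS]rotate_fieldsE distr_sumE chiE mulr_suml -big_split/=.
by apply: eq_bigr => j _; rewrite SE mulrDr mulrA.
Qed.

Lemma ig_class_eqP c X Y :
  ig_class c X = ig_class c Y <-> forall Z, ig_equiv c X Z <-> ig_equiv c Y Z.
Proof.
split=> [XY Z|XY].
  by have /= E := congr1 (fun s => embeddings s Z) XY; rewrite E.
rewrite /ig_class; move: (ex_intro _ X _) (ex_intro _ Y _).
have -> : [set Z | ig_equiv c X Z] = [set Z | ig_equiv c Y Z].
  by apply/seteqP; split => Z /= /XY.
by move=> p q; congr IGSurface; exact: Prop_irrelevance.
Qed.

Section RotateSurface.
Context (A : 'M[R]_n) (c c' : 'I_n -> R).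
Hypothesis A_orth : A *m A^T = 1%:M.
Hypothesis chiE : forall i, chi (c' i) = \sum_j A i j * chi (c j).

Let AtA : A^T *m A = 1%:M.
Proof. exact: mulmx1C. Qed.

Lemma chi_unrotate j : chi (c j) = \sum_i A^T j i * chi (c' i).
Proof.
under eq_bigr => i _ do rewrite chiE.
by rewrite left_inverse_sum.
Qed.

(** A^T undoes A both on fields and on chi, so the class of a rotated embedding is the
rotated class. *)
Lemma ig_equiv_rotateE X Y :
  ig_equiv c' (rotate_embedding A X) Y <-> ig_equiv c X (rotate_embedding A^T Y).
Proof.
split=> [/(ig_equiv_rotate chi_unrotate)|/(ig_equiv_rotate chiE)].
  by rewrite (rotate_embeddingK AtA).
by rewrite (rotate_embeddingK A_orth).
Qed.

Lemma ig_class_rotate X Y : ig_class c X = ig_class c Y ->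
  ig_class c' (rotate_embedding A X) = ig_class c' (rotate_embedding A Y).
Proof.
by move=> /ig_class_eqP XY; apply/ig_class_eqP => Z; rewrite !ig_equiv_rotateE.
Qed.

(** Computed on an arbitrary embedding of the surface; by [ig_class_rotate] the result
does not depend on which one. *)
Definition rotate_surface (s : ig_surface c) : ig_surface c' :=
  ig_class c' (rotate_embedding A (sval (cid (embeddingsP s)))).

Lemma rotate_surface_class X :
  rotate_surface (ig_class c X) = ig_class c' (rotate_embedding A X).
Proof.
rewrite /rotate_surface; case: cid => Y /= XY; apply: ig_class_rotate.
by apply/ig_class_eqP => Z; have := congr1 (fun E => E Z) XY => /= ->.
Qed.

Lemma measurable_rotate_fields (D : set (Cplx R)) :
  measurable_fun setT (@rotate_fields R n A D).
Proof.
apply/measurable_fun_tnthP => i; apply: measurable_fun_distr => phi.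
under eq_fun do rewrite /= rotate_fieldsE.
apply: measurable_sum => j; apply: measurable_funM => //.
exact: (measurableT_comp (measurable_distr_eval phi) (measurable_tnth j)).
Qed.

Lemma measurable_rotate_surface : measurable_fun setT rotate_surface.
Proof.
move=> _ E mE; rewrite setTI.
suff : ig_measurable (rotate_surface @^-1` E) by [].
move=> D oD bD x Dx.
have := @measurable_rotate_fields D measurableT _ (mE D oD bD x Dx).
rewrite setTI; congr measurable; apply/seteqP; split => Psi /=;
  by rewrite rotate_surface_class.
Qed.

End RotateSurface.
End RotationOfSurfaces.

(** * Invariance of the law of IG surfaces *)

(** Both the one-dimensional laws and independence are read off the joint law. *)
Lemma rotated_GFFs (R : realType) d (Omega : measurableType d)
    (P : probability Omega R) (n : nat) (A : 'M[R]_n)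
    (h hh : 'I_n -> {RV P >-> distr (@disk R)}) :
  A *m A^T = 1%:M -> (forall i, zero_boundary_GFF (h i)) ->
  mutually_independent h -> (forall i w, hh i w = \sum_j A i j *: h j w) ->
  (forall i, zero_boundary_GFF (hh i)) /\ mutually_independent hh.
Proof.
move=> A_orth gff indep hhE.
pose var (phi : testfun (@disk R)) := Num.sqrt (green_energy phi) ^+ 2.
have hcos i phi : \int[P]_w cos (h i w phi) = expR (- (var phi / 2)).
  exact: GFF_cos.
have hsin i phi : \int[P]_w sin (h i w phi) = 0 by exact: GFF_sin.
have hsqr i phi : (\int[P]_w (h i w phi ^+ 2)%:E = (var phi)%:E)%E.
  exact: GFF_sqr.
have joint E (mE : forall i, measurable (E i)) (k : 'I_n) :=
  rotated_fields_joint_law hcos hsin hsqr indep k A_orth hhE mE.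
have marginal i (F : set (distr (@disk R))) : measurable F ->
    P [set w | F (hh i w)] = P [set w | F (h i w)].
  move=> mF; pose E j := if j == i then F else setT.
  have mE j : measurable (E j) by rewrite /E; case: ifP.
  (* One event is a family of events that is trivial at the other indices. *)
  have EE (g : 'I_n -> {RV P >-> distr (@disk R)}) :
      [set w | F (g i w)] = [set w | forall j, E j (g j w)].
    apply/seteqP; split => w /= H; last by have := H i; rewrite /E eqxx.
    by move=> j; rewrite /E; case: eqP => [->|].
  by rewrite !EE joint.
split=> [i phi B mB|E mE].
  rewrite -(gff i)//; apply: (marginal i [set T : distr (@disk R) | B (T phi)]).
  by apply: sub_sigma_algebra; exists phi, B.
transitivity (P [set w | forall i, E i (h i w)]).
  case: (pickP (fun _ : 'I_n => true)) => [k _|n0].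
    exact: joint.
  by congr (P _); apply/seteqP; split => w _ i; have := n0 i.
by rewrite indep//; apply: eq_bigr => i _; exact/esym/marginal.
Qed.

Unset Implicit Arguments.

Theorem proposition1p17 (R : realType) (n : nat) (n_ge1 : (1 <= n)%N)
    (A : 'M[R]_n) (A_orth : A *m A^T = 1%:M)
    (c : 'I_n -> R) (c_le1 : forall i, c i <= 1)
    (hat_chi : 'I_n -> R)
    (hat_chiE : forall i, hat_chi i = \sum_(j < n) A i j * chi (c j))
    (hat_chi_ge0 : forall i, 0 <= hat_chi i)
    (hat_c : 'I_n -> R) (hat_cE : forall i, hat_c i = 1 - 6 * hat_chi i ^+ 2) :
  [/\ \sum_(i < n) hat_c i = \sum_(i < n) c i,
      (forall Psi Psi' : n.-tuple (distr (@disk R)),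
        ig_class c (disk_embedding Psi) = ig_class c (disk_embedding Psi') ->
        ig_class hat_c (disk_embedding (rotate_fields A Psi)) =
        ig_class hat_c (disk_embedding (rotate_fields A Psi'))) &
      (forall (d : measure_display) (Omega : measurableType d)
          (P : probability Omega R) (Psi : Omega -> n.-tuple (distr (@disk R)))
          (S : {RV P >-> ig_surface c}),
        (forall w, S w = ig_class c (disk_embedding (Psi w))) ->
        IG_law (distribution P S) ->
        exists2 hat_S : {RV P >-> ig_surface hat_c},
          forall w, hat_S w =
            ig_class hat_c (disk_embedding (rotate_fields A (Psi w))) &
          IG_law (distribution P hat_S))].
Proof.
have chi_hat i : chi (hat_c i) = \sum_j A i j * chi (c j).
  rewrite /chi hat_cE opprB addrCA subrr addr0 mulrC mulKf//.
  by rewrite sqrtr_sqr ger0_norm ?hat_chi_ge0// hat_chiE.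
split.
- have AT_orth : A^T *m A^T^T = 1%:M by rewrite trmxK; exact: mulmx1C.
  have sumsq : \sum_i hat_chi i ^+ 2 = \sum_i chi (c i) ^+ 2.
    rewrite -[RHS](sum_sqr_orthogonal _ AT_orth); apply: eq_bigr => i _.
    by rewrite hat_chiE; congr (_ ^+ 2); apply: eq_bigr => j _; rewrite mxE.
  transitivity (\sum_(i < n) (1 - 6 * hat_chi i ^+ 2)).
    by apply: eq_bigr => i _.
  rewrite sumrB -mulr_sumr sumsq mulr_sumr -sumrB; apply: eq_bigr => i _.
  rewrite /chi sqr_sqrtr ?divr_ge0 ?subr_ge0//; by field.
- move=> Psi Psi'; exact: ig_class_rotate.
- move=> d Omega P Psi S SE [d2 [W2 [P2 [h [frakh [Psi2 [gff indep fh PsiE law]]]]]]].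
  have mrot := measurable_rotate_surface A_orth chi_hat.
  have mhS : measurable_fun setT (rotate_surface A hat_c \o S).
    exact: measurableT_comp.
  pose hat_S : {RV P >-> ig_surface hat_c} := mfun_Sub (mem_set mhS).
  exists hat_S.
    by move=> w; rewrite /= SE rotate_surface_class.
  have mhh i : measurable_fun setT (fun w => \sum_j A i j *: h j w).
    apply: measurable_fun_distr => phi.
    under eq_fun do rewrite distr_sumE.
    apply: measurable_sum => j; apply: measurable_funM => //.
    exact: measurable_RV_eval.
  pose hh i : {RV P2 >-> distr (@disk R)} := mfun_Sub (mem_set (mhh i)).
  have [gffh indeph] := @rotated_GFFs _ _ _ _ _ _ h hh A_orth gff indep (fun _ _ => erefl).
  exists d2, W2, P2, hh, frakh, (fun w => rotate_fields A (Psi2 w)).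
  split=> //.
    move=> w i phi; rewrite rotate_fieldsE /= distr_sumE chi_hat mulr_suml -big_split/=.
    by apply: eq_bigr => j _; rewrite PsiE mulrDr mulrA.
  move=> E mE.
  have := mrot measurableT E mE; rewrite setTI => mrE.
  rewrite -[LHS]/(distribution P S (rotate_surface A hat_c @^-1` E)) law//.
  congr (P2 _); apply/seteqP; split => w /=;
    by rewrite rotate_surface_class.
Qed.
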